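(* Let $d\ge 2$, $a>0$, $m_1>0$, $m_2\in\mathbb{R}$. On the region $\mathcal{R}\subset T\mathbb{R}^d$ let $E_{Eucl,a}=E_{Kep}+\langle V_{Eucl,2}\rangle$ be the Hamiltonian of the partially-averaged two-center problem, obtained by averaging the potential $V_{Eucl,2}$ of the second center along the closed orbits of the Kepler problem $E_{Kep}$ of the first center, and let $D$ be the function $D=C^2-2hA_1$ with $h=a/\sqrt{1+a^2}$ (all as defined in the context). Then $D$ is a first integral of the partially-averaged system: $$\{E_{Eucl,a},D\}=0\quad\text{on }\mathcal{R}.$$
   Context: Coordinates: $T\mathbb{R}^d$ has points $(q,v)$ with $q=(\xi,\eta)\in\mathbb{R}^{d-1}\times\mathbb{R}$ and $v=\dot q=(\dot\xi,\dot\eta)$. It carries the standard Euclidean norm and inner product, and the Poisson bracket transported from $T^*\mathbb{R}^d$ by the Legendre transformation of the standard kinetic energy $\frac12\|v\|^2$ (so $\{q_i,v_j\}=\delta_{ij}$ up to a global sign convention, other brackets of coordinates zero). Centers: the first Kepler center, of mass $m_1$, is at the origin; the second, of mass $m_2$, is at $Z_2=(0,-2h)$, where $h=a/\sqrt{1+a^2}$ is half the distance between the centers. (Equivalently, the centers are at $(0,\pm a)$ in $\mathbb{R}^d$ with the norm $\|(u_1,\dots,u_d)\|_a=\sqrt{u_1^2+\dots+u_{d-1}^2+u_d^2/(1+a^2)}$, and the affine change $x=\xi$, $y=\sqrt{1+a^2}\,\eta+a$ normalizes the norm.) Energies: $E_{Kep}=\frac12\|v\|^2-\frac{m_1}{\|q\|}$,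 $V_{Eucl,2}=-\frac{m_2}{\|q-Z_2\|}$, $E_{Eucl}=E_{Kep}+V_{Eucl,2}$. Region: let $\mathcal{I}$ be the union of the orbits of $E_{Kep}$ in $T\mathbb{R}^d$ whose projections to $\mathbb{R}^d$ pass through $Z_2$, and let $C_{Kep}$ be the angular momentum $q\wedge v$ with respect to the first center. Then $\mathcal{R}=\{E_{Kep}<0,\ C_{Kep}\ne 0\}\subset T\mathbb{R}^d\setminus\mathcal{I}$. All orbits of $E_{Kep}$ in $\mathcal{R}$ are closed. Average: for $z\in\mathcal{R}$, $\langle V_{Eucl,2}\rangle(z)=\int_{S^1}V_{Eucl,2}\,ds=\frac1T\int_0^T V_{Eucl,2}(\varphi_t(z))\,dt$, where $\varphi_t$ is the flow of $E_{Kep}$ and $T=T(z)$ is the period of the orbit of $z$. The function $D$: $C^2=\|q\|^2\|v\|^2-(q\cdot v)^2$ is the squared angular momentum with respect to the first center, and $A_1$ is the component of the Laplace-Runge-Lenz vector $A=\|v\|^2q-(q\cdot v)v-m_1\frac{q}{\|q\|}$ in the direction from the first to the second center, i.e. $A_1=-A_\eta$ where $A_\eta$ is the $\eta$-component of $A$. Then $D=C^2-2hA_1=C^2+\frac{2a}{\sqrt{1+a^2}}A_\eta$. For $d=2$ this reads $D=(\xi\dot\eta-\eta\dot\xi)^2-\frac{2a}{\sqrt{1+a^2}}\Big((\xi\dot\eta-\eta\dot\xi)\dot\xi+\frac{m_1\eta}{\sqrt{\xi^2+\eta^2}}\Big)$. *)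

(* Defs.v *)
From mathcomp Require Import all_boot all_order all_algebra.
From mathcomp Require Import all_classical all_reals all_analysis.
Import Order.TTheory GRing.Theory Num.Theory numFieldNormedType.Exports.

Set Implicit Arguments.
Unset Strict Implicit.
Unset Printing Implicit Defensive.

Local Open Scope classical_set_scope.
Local Open Scope ring_scope.

(* The norm carried by 'rV[R]_d in the library is the sup norm; it is used only
   for the topology and for differentiability.  All formulas of mechanics use
   the Euclidean inner product and norm below. *)
Definition dotv (R : realType) (d : nat) (u w : 'rV[R]_d) : R :=
  \sum_(i < d) u 0 i * w 0 i.

Definition enorm (R : realType) (d : nat) (u : 'rV[R]_d) : R :=
  Num.sqrt (dotv u u).

(* The bivector q /\ v, as the antisymmetric matrix (q_i v_j - q_j v_i). *)
Definition bivector (R : realType) (d : nat) (q v : 'rV[R]_d) : 'M[R]_d :=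
  \matrix_(i, j) (q 0 i * v 0 j - q 0 j * v 0 i).

(* Written for all d; for d > 0 this is the last vector of the standard basis,
   i.e. the direction of the eta axis in R^(d-1) x R. *)
Definition eta_axis (R : realType) (d : nat) : 'rV[R]_d :=
  \row_j (j.+1 == d)%:R.

Definition half_dist (R : realType) (a : R) : R := a / Num.sqrt (1 + a ^+ 2).

Definition center2 (R : realType) (d : nat) (a : R) : 'rV[R]_d :=
  - (2 * half_dist a) *: eta_axis R d.

Definition dq (R : realType) (d : nat) (F : 'rV[R]_d * 'rV[R]_d -> R)
    (i : 'I_d) (z : 'rV[R]_d * 'rV[R]_d) : R :=
  'D_(delta_mx 0 i, 0) F z.

Definition dv (R : realType) (d : nat) (F : 'rV[R]_d * 'rV[R]_d -> R)
    (i : 'I_d) (z : 'rV[R]_d * 'rV[R]_d) : R :=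
  'D_(0, delta_mx 0 i) F z.

(* Sign convention: {q_i, v_j} = delta_ij. *)
Definition poisson (R : realType) (d : nat)
    (F G : 'rV[R]_d * 'rV[R]_d -> R) (z : 'rV[R]_d * 'rV[R]_d) : R :=
  \sum_(i < d) (dq F i z * dv G i z - dv F i z * dq G i z).

Definition ham_field (R : realType) (d : nat)
    (H : 'rV[R]_d * 'rV[R]_d -> R) (z : 'rV[R]_d * 'rV[R]_d) :
    'rV[R]_d * 'rV[R]_d :=
  (\row_i dv H i z, \row_i (- dq H i z)).

Definition E_Kep (R : realType) (d : nat) (m1 : R)
    (z : 'rV[R]_d * 'rV[R]_d) : R :=
  enorm z.2 ^+ 2 / 2 - m1 / enorm z.1.

Definition V_Eucl2 (R : realType) (d : nat) (a m2 : R) (q : 'rV[R]_d) : R :=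
  - (m2 / enorm (q - center2 d a)).

(* Solutions of Hamilton's equations of E_Kep on an open set J of times; the
   phase space of E_Kep excludes the collisions q = 0, where the division by
   zero in E_Kep would otherwise be given a junk value. *)
Definition kepler_solution (R : realType) (d : nat) (m1 : R) (J : set R)
    (g : R -> 'rV[R]_d * 'rV[R]_d) : Prop :=
  forall t, J t ->
    (g t).1 != 0 /\ is_derive t 1 g (ham_field (E_Kep m1) (g t)).

Definition through_center2 (R : realType) (d : nat) (a m1 : R) :
    set ('rV[R]_d * 'rV[R]_d) :=
  [set z | exists (l r t : R) (g : R -> 'rV[R]_d * 'rV[R]_d),
    [/\ l < 0 < r, l < t < r,
        kepler_solution m1 [set s | l < s < r] g,
        g 0 = z & (g t).1 = center2 d a]].

Definition regionR (R : realType) (d : nat) (a m1 : R) :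
    set ('rV[R]_d * 'rV[R]_d) :=
  [set z | [/\ E_Kep m1 z < 0, bivector z.1 z.2 != 0
             & ~ through_center2 a m1 z]].

(* kepler_flow m1 z t is phi_t(z).  It is meaningful at the points z whose
   solution exists for all times, which is the case when the angular momentum
   does not vanish; elsewhere it is unspecified. *)
Definition kepler_flow (R : realType) (d : nat) (m1 : R)
    (z : 'rV[R]_d * 'rV[R]_d) : R -> 'rV[R]_d * 'rV[R]_d :=
  get [set g : R -> 'rV[R]_d * 'rV[R]_d | kepler_solution m1 setT g /\ g 0 = z].

(* The minimal period. *)
Definition kepler_period (R : realType) (d : nat) (m1 : R)
    (z : 'rV[R]_d * 'rV[R]_d) : R :=
  inf [set T : R | 0 < T /\ kepler_flow m1 z T = z].

Definition V_avg (R : realType) (d : nat) (a m1 m2 : R)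
    (z : 'rV[R]_d * 'rV[R]_d) : R :=
  (kepler_period m1 z)^-1 *
  (\int[@lebesgue_measure R]_(t in `[0%R, kepler_period m1 z])
     V_Eucl2 a m2 (kepler_flow m1 z t).1)%R.

Definition E_avg (R : realType) (d : nat) (a m1 m2 : R)
    (z : 'rV[R]_d * 'rV[R]_d) : R :=
  E_Kep m1 z + V_avg a m1 m2 z.

Definition sq_ang_mom (R : realType) (d : nat) (z : 'rV[R]_d * 'rV[R]_d) : R :=
  enorm z.1 ^+ 2 * enorm z.2 ^+ 2 - dotv z.1 z.2 ^+ 2.

Definition laplace_vec (R : realType) (d : nat) (m1 : R)
    (z : 'rV[R]_d * 'rV[R]_d) : 'rV[R]_d :=
  enorm z.2 ^+ 2 *: z.1 - dotv z.1 z.2 *: z.2 - (m1 / enorm z.1) *: z.1.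

(* The unit vector from the first to the second center is - eta_axis. *)
Definition laplace_A1 (R : realType) (d : nat) (m1 : R)
    (z : 'rV[R]_d * 'rV[R]_d) : R :=
  dotv (laplace_vec m1 z) (- eta_axis R d).

Definition D_int (R : realType) (d : nat) (a m1 : R)
    (z : 'rV[R]_d * 'rV[R]_d) : R :=
  sq_ang_mom z - 2 * half_dist a * laplace_A1 m1 z.

(* Main.v *)
Require Import Defs.
From HB Require Import structures.
From mathcomp Require Import all_boot all_order all_algebra.
From mathcomp Require Import all_classical all_reals all_analysis.
From mathcomp Require Import ring lra.
Import Order.TTheory GRing.Theory Num.Theory numFieldNormedType.Exports.

Set Implicit Arguments.
Unset Strict Implicit.
Unset Printing Implicit Defensive.

Local Open Scope classical_set_scope.
Local Open Scope ring_scope.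

(** In the eccentric anomaly [u], with [dt = (R / w) du] and [w^2 = - 2 E_Kep],
    a Kepler orbit and its radius [R] are trigonometric polynomials of degree
    one in [u], with coefficients explicit in the initial point [z].  This turns
    the average of the second potential into
    [w / (2 pi rho)] times the integral over [0 <= u <= 2 pi] of
    [- m2 R / (w sqrt N)], where [rho = m1 / w^2], [N = R^2 + 4 h Y + 4 h^2] is
    the squared distance to the second center and [Y] the eta-coordinate.  The
    integration domain no longer depends on [z], so one may differentiate under
    the integral.  Writing ['] for [d/du], [y, r] for the values of [Y, R] at
    [u = 0], and [{., D}] for the derivative in the direction of the Hamiltonian
    field of [D], one finds [{w, D} = 0] and
      [{R, D} = 2 h w ((y / r) R' - Y')],
      [{Y, D} = 2 w (R Y' - R' Y) - 2 h w R' + 2 h w (y / r) Y'],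
    hence [{- m2 R / (w sqrt N), D} = P'] for the periodic function
      [P = 2 h m2 (2 Y + 2 h - (y / r) R) / sqrt N],
    and the bracket of the average with [D] vanishes. *)

(** * Derivatives *)

(** Differentiability is kept beside the value in one direction, because a sum of partial
    derivatives is the derivative in the summed direction only for a differentiable function. With
    both stored, sum, product and chain rules compose without ever writing a full differential. *)
Definition diff_along (R : realType) (V : normedModType R) (f : V -> R)
    (z X : V) (l : R) : Prop := differentiable f z /\ 'd f z X = l.

Section DiffAlong.
Context {R : realType} {V : normedModType R}.
Implicit Types (f g : V -> R) (z X : V).

Lemma diff_along_eq f z X l l' :
  diff_along f z X l -> l = l' -> diff_along f z X l'.
Proof. by move=> ? <-. Qed.

Lemma diff_along_is_diff f df z X : is_diff z f df -> diff_along f z X (df X).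
Proof. by case=> Hd <-. Qed.

Lemma diff_along_cst c z X : diff_along (fun _ : V => c) z X 0.
Proof. exact: (diff_along_is_diff _ (is_diff_cst c z)). Qed.

Lemma diff_along_add f g z X a b : diff_along f z X a -> diff_along g z X b ->
  diff_along (fun w => f w + g w) z X (a + b).
Proof.
move=> [/differentiableP df <-] [/differentiableP dg <-].
exact: (diff_along_is_diff _ (is_diffD df dg)).
Qed.

Lemma diff_along_opp f z X a : diff_along f z X a ->
  diff_along (fun w => - f w) z X (- a).
Proof.
move=> [/differentiableP df <-].
exact: (diff_along_is_diff _ (is_diffN df)).
Qed.

Lemma diff_along_mul f g z X a b : diff_along f z X a -> diff_along g z X b ->
  diff_along (fun w => f w * g w) z X (f z * b + g z * a).
Proof.
move=> [/differentiableP df <-] [/differentiableP dg <-].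
exact: (diff_along_is_diff _ (is_diffM df dg)).
Qed.

Lemma diff_along_comp f z X a (p : R -> R) (b : R) : diff_along f z X a ->
  is_derive (f z) 1 p b -> diff_along (fun w => p (f w)) z X (b * a).
Proof.
move=> [/differentiableP df <-] [/derivable1_diffP dp pb].
have dp' := differentiableP dp.
have := diff_along_is_diff X (is_diff_comp df dp').
move=> /diff_along_eq; apply => /=.
by rewrite diff1E// derive1E pb mulrC.
Qed.

Lemma diff_along_inv f z X a : f z != 0 -> diff_along f z X a ->
  diff_along (fun w => (f w)^-1) z X (- (f z) ^- 2 * a).
Proof.
by move=> fz0 [df <-]; split; [exact: differentiableV|rewrite diffV].
Qed.

Lemma diff_along_sqrt f z X a : 0 < f z -> diff_along f z X a ->
  diff_along (fun w => Num.sqrt (f w)) z X ((2 * Num.sqrt (f z))^-1 * a).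
Proof. by move=> /is_derive1_sqrt fz df; apply: diff_along_comp df fz. Qed.

Lemma diff_along_rsqrt f z X a : 0 < f z -> diff_along f z X a ->
  diff_along (fun w => (Num.sqrt (f w))^-1) z X (- (a / (2 * Num.sqrt (f z) ^+ 3))).
Proof.
move=> fz df; have s0 : Num.sqrt (f z) != 0 by rewrite lt0r_neq0// sqrtr_gt0.
apply: diff_along_eq (diff_along_inv (f := fun w => Num.sqrt (f w)) s0
  (diff_along_sqrt fz df)) _.
by field.
Qed.

Lemma diff_along_exp f z X a n : diff_along f z X a ->
  diff_along (fun w => f w ^+ n.+1) z X (n.+1%:R * f z ^+ n * a).
Proof.
move=> [/differentiableP df <-].
rewrite (_ : (fun w => _) = f ^+ n.+1); last first.
  by apply/funext => w; rewrite exprfctE.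
exact: (diff_along_is_diff _ (is_diffX n df)).
Qed.

Lemma diff_along_sum n (f : 'I_n -> V -> R) z X (a : 'I_n -> R) :
  (forall i, diff_along (f i) z X (a i)) ->
  diff_along (fun w => \sum_(i < n) f i w) z X (\sum_(i < n) a i).
Proof.
elim: n f a => [|n IH] f a H.
  rewrite big_ord0 (_ : (fun _ => _) = fun=> 0); first exact: diff_along_cst.
  by apply/funext => w; rewrite big_ord0.
rewrite big_ord_recl.
rewrite (_ : (fun _ => _) =
  fun w => f ord0 w + \sum_(i < n) f (lift ord0 i) w); last first.
  by apply/funext => w; rewrite big_ord_recl.
by apply: diff_along_add => //; exact: IH.
Qed.

(** The first-order expansion at [z] sees only values near [z]. This matters for the average, whose
    closed integral formula is available only in a neighborhood of the given point. *)
Lemma diff_along_near f g z X a : (\forall w \near z, f w = g w) ->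
  diff_along f z X a -> diff_along g z X a.
Proof.
move=> fg [df dfa].
have fgz : f z = g z by exact: (nbhs_singleton fg).
have /diff_locallyP[cf ef] := df.
have fg0 : \forall h \near 0, f (h + z) = g (h + z).
  move: fg; rewrite (near_shift 0 z); apply: filterS => h /=.
  by rewrite subr0.
have eg : g \o shift z = cst (g z) + 'd f z +o_ 0 id.
  apply/eqaddoP => e e0.
  have /eqaddoP/(_ _ e0) := ef.
  by apply: filterS2 fg0 => h fgh; rewrite !fctE /= fgz fgh.
have dg : 'd g z = 'd f z :> (V -> R) by apply: diff_unique.
split; last by rewrite dg.
by apply/diff_locallyP; rewrite dg.
Qed.

End DiffAlong.

Section DiffAlongReal.
Context {R : realType}.

Lemma is_derive_diff_along (f : R -> R) (t l : R) :
  is_derive t 1 f l -> diff_along f t 1 l.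
Proof.
move=> [df <-]; split; first exact/derivable1_diffP.
by rewrite deriveE//; exact/derivable1_diffP.
Qed.

Lemma diff_along_is_derive (f : R -> R) (t l : R) :
  diff_along f t 1 l -> is_derive t 1 f l.
Proof.
move=> [df <-]; split; first exact/derivable1_diffP.
by rewrite deriveE.
Qed.

Lemma diff_along_id (t : R) : diff_along (fun x : R => x) t 1 1.
Proof. apply: is_derive_diff_along; exact: is_derive_id. Qed.

Lemma diff_along_cos (t : R) : diff_along (@cos R) t 1 (- sin t).
Proof. apply: is_derive_diff_along; exact: is_derive_cos. Qed.

Lemma diff_along_sin (t : R) : diff_along (@sin R) t 1 (cos t).
Proof. apply: is_derive_diff_along; exact: is_derive_sin. Qed.

End DiffAlongReal.

(** * Phase space *)

Section Dot.
Context {R : realType} {d : nat}.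
Implicit Types u v w : 'rV[R]_d.

Lemma dotvC u w : dotv u w = dotv w u.
Proof. by apply: eq_bigr => i _; rewrite mulrC. Qed.

Lemma dotvDl u v w : dotv (u + v) w = dotv u w + dotv v w.
Proof. by rewrite -big_split; apply: eq_bigr => i _; rewrite !mxE mulrDl. Qed.

Lemma dotvZl c u w : dotv (c *: u) w = c * dotv u w.
Proof. by rewrite mulr_sumr; apply: eq_bigr => i _; rewrite !mxE mulrA. Qed.

Lemma dotvNl u w : dotv (- u) w = - dotv u w.
Proof. by rewrite -scaleN1r dotvZl mulN1r. Qed.

Lemma dotvDr u v w : dotv w (u + v) = dotv w u + dotv w v.
Proof. by rewrite dotvC dotvDl !(dotvC w). Qed.

Lemma dotvZr c u w : dotv w (c *: u) = c * dotv w u.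
Proof. by rewrite dotvC dotvZl (dotvC w). Qed.

Lemma dotvNr u w : dotv w (- u) = - dotv w u.
Proof. by rewrite dotvC dotvNl (dotvC w). Qed.

Lemma dotv0l w : dotv 0 w = 0.
Proof. by rewrite -(scale0r 0) dotvZl mul0r. Qed.

Lemma dotv0r w : dotv w 0 = 0.
Proof. by rewrite dotvC dotv0l. Qed.

Definition dotvE :=
  (dotvDl, dotvDr, dotvNl, dotvNr, dotvZl, dotvZr, dotv0l, dotv0r).

Lemma dotv_deltal i w : dotv (delta_mx 0 i) w = w 0 i.
Proof.
rewrite /dotv (bigD1 i)//= big1 => [|j /negPf ji]; rewrite !mxE ?eqxx.
  by rewrite mul1r addr0.
by rewrite ji andbF mul0r.
Qed.

Lemma dotv_deltar i w : dotv w (delta_mx 0 i) = w 0 i.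
Proof. by rewrite dotvC dotv_deltal. Qed.

Lemma dotv_ge0 u : 0 <= dotv u u.
Proof. by apply: sumr_ge0 => i _; rewrite -expr2 sqr_ge0. Qed.

Lemma dotv_eq0 u : (dotv u u == 0) = (u == 0).
Proof.
apply/idP/eqP => [|->]; last by rewrite dotv0l.
rewrite psumr_eq0 => [/allP u0|i _]; last by rewrite -expr2 sqr_ge0.
apply/rowP => i; apply/eqP; rewrite mxE -sqrf_eq0 expr2.
by apply: u0; rewrite mem_index_enum.
Qed.

Lemma dotv_gt0 u : u != 0 -> 0 < dotv u u.
Proof. by move=> u0; rewrite lt_def dotv_eq0 u0 dotv_ge0. Qed.

Lemma enorm_sqr u : enorm u ^+ 2 = dotv u u.
Proof. by rewrite sqr_sqrtr// dotv_ge0. Qed.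

Lemma enorm_gt0 u : u != 0 -> 0 < enorm u.
Proof. by move=> u0; rewrite sqrtr_gt0 dotv_gt0. Qed.

Lemma enorm_neq0 u : u != 0 -> enorm u != 0.
Proof. by move=> /enorm_gt0 /lt0r_neq0. Qed.

End Dot.

Lemma dotv_eta_axis (R : realType) d : dotv (eta_axis R d.+1) (eta_axis R d.+1) = 1.
Proof.
rewrite (_ : eta_axis R d.+1 = delta_mx 0 ord_max) ?dotv_deltal ?mxE ?eqxx//.
by apply/rowP => j; rewrite !mxE eqSS.
Qed.

Lemma diff_along_linear (R : realType) (V : normedModType R) (f : V -> R)
    (z X : V) : linear f -> continuous f -> diff_along f z X (f X).
Proof.
move=> lf cf.
pose fM := GRing.isLinear.Build _ _ _ _ _ (lf : linear (f : V -> R^o)).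
pose fL : {linear V -> R} := HB.pack f fM.
split; first exact: (@linear_differentiable _ _ _ fL z cf).
by rewrite -[f]/(fL : V -> R) diff_lin.
Qed.

Section PhaseSpace.
Context {R : realType} {d : nat}.
Notation phase := ('rV[R]_d * 'rV[R]_d)%type.
Notation eta := (eta_axis R d).
Implicit Types (z X : phase) (e : 'rV[R]_d).

Lemma diff_along_q i z X : diff_along (fun w : phase => w.1 0 i) z X (X.1 0 i).
Proof.
apply: (@diff_along_linear _ _ (fun w : phase => w.1 0 i)).
  by move=> k u v; rewrite !mxE.
move=> x; apply: (@continuous_comp _ _ _ fst (fun M : 'rV[R]_d => M 0 i)).
  exact: cvg_fst.
exact: coord_continuous.
Qed.

Lemma diff_along_v i z X : diff_along (fun w : phase => w.2 0 i) z X (X.2 0 i).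
Proof.
apply: (@diff_along_linear _ _ (fun w : phase => w.2 0 i)).
  by move=> k u v; rewrite !mxE.
move=> x; apply: (@continuous_comp _ _ _ snd (fun M : 'rV[R]_d => M 0 i)).
  exact: cvg_snd.
exact: coord_continuous.
Qed.

End PhaseSpace.

(** Vector-valued maps enter through their coordinates only, so the scalar calculus of [diff_along]
    covers phase-space functions and curves alike. *)
Lemma diff_along_dotv (R : realType) (V : normedModType R) (d : nat)
    (f g : V -> 'rV[R]_d) (z X : V) (df dg : 'rV[R]_d) :
  (forall i, diff_along (fun w => f w 0 i) z X (df 0 i)) ->
  (forall i, diff_along (fun w => g w 0 i) z X (dg 0 i)) ->
  diff_along (fun w => dotv (f w) (g w)) z X (dotv (f z) dg + dotv df (g z)).
Proof.
move=> Hf Hg; rewrite -big_split /=.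
apply: diff_along_sum => i; apply: diff_along_eq.
  by apply: diff_along_mul; [exact: Hf|exact: Hg].
by congr (_ + _); rewrite mulrC.
Qed.

Lemma diff_along_dotv_cst (R : realType) (V : normedModType R) (d : nat)
    (f : V -> 'rV[R]_d) (z X : V) (df e : 'rV[R]_d) :
  (forall i, diff_along (fun w => f w 0 i) z X (df 0 i)) ->
  diff_along (fun w => dotv (f w) e) z X (dotv df e).
Proof.
move=> Hf; apply: diff_along_eq.
  apply: (diff_along_dotv (dg := 0)) Hf _ => i.
  by rewrite [X in diff_along _ _ _ X]mxE; exact: diff_along_cst.
by rewrite dotv0r add0r.
Qed.

Lemma diff_along_enorm (R : realType) (V : normedModType R) (d : nat)
    (f : V -> 'rV[R]_d) (z X : V) (df : 'rV[R]_d) : f z != 0 ->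
  (forall i, diff_along (fun w => f w 0 i) z X (df 0 i)) ->
  diff_along (fun w => enorm (f w)) z X (dotv (f z) df / enorm (f z)).
Proof.
move=> fz Hf; apply: diff_along_eq.
  by apply: diff_along_sqrt; [exact: dotv_gt0|exact: (diff_along_dotv Hf Hf)].
have := enorm_neq0 fz; rewrite (dotvC df) /enorm => n0.
by field; rewrite n0.
Qed.

(** * The gradients of the Kepler energy and of [D], and brackets with [D] *)

Section Hamiltonian.
Context {R : realType} {d : nat}.
Notation phase := ('rV[R]_d * 'rV[R]_d)%type.
Notation eta := (eta_axis R d).
Implicit Types (z X : phase) (e : 'rV[R]_d).

Lemma diff_along_E_Kep m1 z X : z.1 != 0 ->
  diff_along (E_Kep m1 : phase -> R) z X
    (dotv z.2 X.2 + m1 / enorm z.1 ^+ 3 * dotv z.1 X.1).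
Proof.
move=> q0; have r0 := enorm_neq0 q0.
rewrite (_ : E_Kep m1 = fun w : phase =>
    dotv w.2 w.2 * 2^-1 + - (m1 * (enorm w.1)^-1)); last first.
  by apply/funext => w; rewrite /E_Kep enorm_sqr.
apply: diff_along_eq.
  apply: diff_along_add; first apply: diff_along_mul.
  - by apply: diff_along_dotv => i; exact: diff_along_v.
  - exact: diff_along_cst.
  - apply: diff_along_opp; apply: diff_along_mul; first exact: diff_along_cst.
    by apply: diff_along_inv => //; apply: diff_along_enorm => // i; exact: diff_along_q.
by rewrite (dotvC X.2); field.
Qed.

Lemma ham_field_E_Kep m1 z : z.1 != 0 ->
  ham_field (E_Kep m1) z = (z.2, - (m1 / enorm z.1 ^+ 3) *: z.1).
Proof.
move=> q0; congr (_, _); apply/rowP => i; rewrite !mxE.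
  have [df dfe] := diff_along_E_Kep m1 (0, delta_mx 0 i) q0.
  by rewrite /dv deriveE// dfe /= dotv0r mulr0 addr0 dotv_deltar.
have [df dfe] := diff_along_E_Kep m1 (delta_mx 0 i, 0) q0.
by rewrite /dq deriveE// dfe /= dotv0r add0r dotv_deltar mulNr.
Qed.

Definition grad_v_D (a m1 : R) z : 'rV[R]_d :=
  2 *: (dotv z.1 z.1 *: z.2 - dotv z.1 z.2 *: z.1)
  + (2 * half_dist a) *: ((2 * dotv z.1 eta) *: z.2 - dotv z.2 eta *: z.1
                          - dotv z.1 z.2 *: eta).

Definition grad_q_D (a m1 : R) z : 'rV[R]_d :=
  2 *: (dotv z.2 z.2 *: z.1 - dotv z.1 z.2 *: z.2)
  + (2 * half_dist a) *: ((dotv z.2 z.2 - m1 / enorm z.1) *: eta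
                          - dotv z.2 eta *: z.2
                          + (m1 * dotv z.1 eta / enorm z.1 ^+ 3) *: z.1).

Lemma D_intE a m1 z : D_int a m1 z =
  dotv z.1 z.1 * dotv z.2 z.2 - dotv z.1 z.2 ^+ 2
  + 2 * half_dist a * (dotv z.2 z.2 * dotv z.1 eta
      - dotv z.1 z.2 * dotv z.2 eta - m1 * (enorm z.1)^-1 * dotv z.1 eta).
Proof.
rewrite /D_int /sq_ang_mom /laplace_A1 /laplace_vec !enorm_sqr.
by rewrite !dotvE; ring.
Qed.

Lemma diff_along_D_int a m1 z X : z.1 != 0 ->
  diff_along (D_int a m1 : phase -> R) z X
    (dotv (grad_q_D a m1 z) X.1 + dotv (grad_v_D a m1 z) X.2).
Proof.
move=> q0; have r0 := enorm_neq0 q0.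
have -> := funext (@D_intE a m1).
have hq : diff_along (fun w : phase => dotv w.1 eta) z X (dotv X.1 eta).
  by apply: diff_along_dotv_cst => i; exact: diff_along_q.
have hv : diff_along (fun w : phase => dotv w.2 eta) z X (dotv X.2 eta).
  by apply: diff_along_dotv_cst => i; exact: diff_along_v.
have hs : diff_along (fun w : phase => dotv w.1 w.2) z X
    (dotv z.1 X.2 + dotv X.1 z.2).
  by apply: diff_along_dotv => i; [exact: diff_along_q|exact: diff_along_v].
have hn : diff_along (fun w : phase => dotv w.2 w.2) z X
    (dotv z.2 X.2 + dotv X.2 z.2).
  by apply: diff_along_dotv => i; exact: diff_along_v.
apply: diff_along_eq.
  apply: diff_along_add; first apply: diff_along_add.
  - apply: diff_along_mul; last exact: hn.
    by apply: diff_along_dotv => i; exact: diff_along_q.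
  - by apply: diff_along_opp; apply: diff_along_exp; exact: hs.
  - apply: diff_along_mul; first exact: diff_along_cst.
    apply: diff_along_add; first apply: diff_along_add.
    + exact: (diff_along_mul hn hq).
    + by apply: diff_along_opp; exact: (diff_along_mul hs hv).
    + apply: diff_along_opp; apply: diff_along_mul; last exact: hq.
      apply: diff_along_mul; first exact: diff_along_cst.
      apply: diff_along_inv => //.
      by apply: diff_along_enorm => // i; exact: diff_along_q.
rewrite /grad_q_D /grad_v_D !dotvE.
rewrite (dotvC X.1 z.1) (dotvC X.1 z.2) (dotvC X.2 z.2) !(dotvC eta).
by field.
Qed.

(** The direction is the Hamiltonian field of [D]; expanding it in coordinate vectors and using
    linearity of the differential of [F] gives the bracket term by term. From here on a bracket with
    [D] is one directional derivative. *)
Lemma poisson_D_int a m1 (F : phase -> R) z l : z.1 != 0 ->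
  diff_along F z (grad_v_D a m1 z, - grad_q_D a m1 z) l ->
  poisson F (D_int a m1) z = l.
Proof.
move=> q0 [dF <-].
set A := grad_v_D a m1 z; set B := grad_q_D a m1 z.
have -> : (A, - B) =
    \sum_(i < d) (A 0 i *: ((delta_mx 0 i, 0) : phase)
                 - B 0 i *: ((0, delta_mx 0 i) : phase)).
  rewrite [RHS]surjective_pairing !raddf_sum /=; congr (_, _).
    rewrite {1}(row_sum_delta A); apply: eq_bigr => i _.
    by rewrite scaler0 subr0.
  rewrite {1}(row_sum_delta B) -sumrN; apply: eq_bigr => i _.
  by rewrite scaler0 add0r.
rewrite linear_sum; apply: eq_bigr => i _.
have [dD dDv] := diff_along_D_int a m1 (0, delta_mx 0 i) q0.
have [_ dDq] := diff_along_D_int a m1 (delta_mx 0 i, 0) q0.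
rewrite linearB !linearZ /= /dq /dv !deriveE// dDv dDq.
rewrite /= !dotv0r add0r addr0 !dotv_deltar -/A -/B.
rewrite -[_ *: - B 0 i]/(_ * - B 0 i) -[_ *: _]/(_ * _) -[_ *: _]/(_ * _).
by ring.
Qed.

End Hamiltonian.

(** * Functions along curves, and Newton's equation in coordinates *)

Section Curves.
Context {R : realType} {d : nat}.
Notation phase := ('rV[R]_d * 'rV[R]_d)%type.

Lemma diff_along_curve (g : R -> phase) (F : phase -> R) (t l : R) (Y : phase) :
  is_derive t 1 g Y -> diff_along F (g t) Y l ->
  diff_along (fun x => F (g x)) t 1 l.
Proof.
move=> [dg gY] [dF <-].
have dg' : differentiable g t by exact/derivable1_diffP.
split; first exact: differentiable_comp.
by rewrite (diff_comp dg' dF) /= -gY deriveE.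
Qed.

Lemma is_derive_curve (g : R -> phase) (t : R) (Y : phase) :
  (forall i, diff_along (fun x => (g x).1 0 i) t 1 (Y.1 0 i)) ->
  (forall i, diff_along (fun x => (g x).2 0 i) t 1 (Y.2 0 i)) ->
  is_derive t 1 g Y.
Proof.
move=> H1 H2.
have drow (f : R -> 'rV[R]_d) (y : 'rV[R]_d) :
    (forall i, diff_along (fun x => f x 0 i) t 1 (y 0 i)) ->
    differentiable f t /\ 'd f t 1 = y.
  move=> Hf; have df : derivable f t 1.
    apply/derivable_mxP => i j; rewrite (ord1 i).
    by have [] := diff_along_is_derive (Hf j).
  split; first exact/derivable1_diffP.
  rewrite -deriveE; last exact/derivable1_diffP.
  rewrite derive_mx//; apply/rowP => j; rewrite mxE.
  by have [_ ->] := diff_along_is_derive (Hf j).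
have [d1 e1] := drow _ _ H1; have [d2 e2] := drow _ _ H2.
have gE : g = fun x => ((g x).1, (g x).2).
  by apply/funext => x; case: (g x).
rewrite gE; apply: DeriveDef.
  by apply: diff_derivable; exact: differentiable_pair.
rewrite deriveE; last exact: differentiable_pair.
rewrite [LHS](congr1 (fun h => h 1) (diff_pair d1 d2)).
by rewrite [RHS]surjective_pairing -e1 -e2.
Qed.

Lemma kepler_solution_q m1 J g t i : kepler_solution m1 J g -> J t ->
  diff_along (fun x => (g x : phase).1 0 i) t 1 ((g t).2 0 i).
Proof.
move=> /[apply] -[q0]; rewrite ham_field_E_Kep// => dg.
exact: (diff_along_curve dg (diff_along_q i _ _)).
Qed.

Lemma kepler_solution_v m1 J g t i : kepler_solution m1 J g -> J t ->
  diff_along (fun x => (g x : phase).2 0 i) t 1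
    ((- (m1 / enorm (g t).1 ^+ 3) *: (g t).1) 0 i).
Proof.
move=> /[apply] -[q0]; rewrite ham_field_E_Kep// => dg.
exact: (diff_along_curve dg (diff_along_v i _ _)).
Qed.

End Curves.

(** * Real functions of one variable: constancy, monotonicity, rotations *)

Lemma diff_along_continuous (R : realType) (f : R -> R) (t l : R) :
  diff_along f t 1 l -> {for t, continuous f}.
Proof. by case=> /differentiable_continuous. Qed.

Lemma diff_along0_cst (R : realType) (f : R -> R) (x y : R) :
  (forall t, diff_along f t 1 0) -> f x = f y.
Proof.
by move=> df; apply: is_derive_0_is_cst => t; exact: diff_along_is_derive.
Qed.

Lemma diff_along_gt0_incr (R : realType) (f df : R -> R) :
  (forall t, diff_along f t 1 (df t)) -> (forall t, 0 < df t) ->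
  {homo f : x y / x < y}.
Proof.
move=> fdf df0 x y xy.
have fD t := diff_along_is_derive (fdf t).
apply: (@gtr0_derive1_lt_cc _ _ x y _ _ _ _ _ _ _ xy).
- by move=> t _; have [] := fD t.
- by move=> t _; rewrite derive1E; have [_ ->] := fD t.
- by apply: continuous_subspaceT => t; exact: diff_along_continuous.
- by rewrite in_itv/= lexx (ltW xy).
- by rewrite in_itv/= lexx (ltW xy).
Qed.

(** Turning the pair [(f, g)] back by the angle [th] gives two functions of derivative zero, hence
    constants; undoing the rotation yields the formulas. This takes the place of a uniqueness
    theorem for differential equations below. *)
Lemma rotation_solution (R : realType) (f g th k : R -> R) :
  (forall t, diff_along f t 1 (k t * g t)) ->
  (forall t, diff_along g t 1 (- (k t * f t))) ->
  (forall t, diff_along th t 1 (k t)) -> th 0 = 0 ->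
  forall t, f t = f 0 * cos (th t) + g 0 * sin (th t) /\
            g t = g 0 * cos (th t) - f 0 * sin (th t).
Proof.
move=> df dg dth th0 t.
have dc x : diff_along (fun x => cos (th x)) x 1 (- sin (th x) * k x).
  exact: (diff_along_comp (dth x) (is_derive_cos _)).
have ds x : diff_along (fun x => sin (th x)) x 1 (cos (th x) * k x).
  exact: (diff_along_comp (dth x) (is_derive_sin _)).
have H1 : f t * cos (th t) + - (g t * sin (th t)) = f 0.
  transitivity (f 0 * cos (th 0) + - (g 0 * sin (th 0))); last first.
    by rewrite th0 cos0 sin0; ring.
  apply: (@diff_along0_cst _ (fun x => f x * cos (th x) + - (g x * sin (th x)))).
  move=> x; apply: diff_along_eq.
    apply: diff_along_add; first exact: (diff_along_mul (df x) (dc x)).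
    by apply: diff_along_opp; exact: (diff_along_mul (dg x) (ds x)).
  by rewrite /=; ring.
have H2 : f t * sin (th t) + g t * cos (th t) = g 0.
  transitivity (f 0 * sin (th 0) + g 0 * cos (th 0)); last first.
    by rewrite th0 cos0 sin0; ring.
  apply: (@diff_along0_cst _ (fun x => f x * sin (th x) + g x * cos (th x))).
  move=> x; apply: diff_along_eq.
    apply: diff_along_add; first exact: (diff_along_mul (df x) (ds x)).
    exact: (diff_along_mul (dg x) (dc x)).
  by rewrite /=; ring.
rewrite -H1 -H2.
have CS : sin (th t) ^+ 2 = 1 - cos (th t) ^+ 2 by rewrite sin2cos2.
by split; ring: CS.
Qed.

(** * Kepler orbits *)

(* Elliptic motion in the eccentric anomaly [u], counted from the initial
   point: [dt = (orbit_rad u / kfreq) du].  The coefficients of [q] and [v] in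
   [orbit_pos] are Lagrange's [f] and [g]; unlike the usual description by the
   axes of the ellipse they are regular at circular orbits. *)
Section OrbitDefs.
Context {R : realType} {d : nat} (m1 : R) (z : 'rV[R]_d * 'rV[R]_d).

(** The square root of [- 2 * E_Kep]: the frequency of the motion in the regularized time whose
    differential is [dt] divided by the radius. *)
Definition kfreq : R := Num.sqrt (2 * m1 / enorm z.1 - dotv z.2 z.2).

Definition semi_axis : R := m1 / kfreq ^+ 2.

Definition lagrange_f (u : R) : R := 1 - semi_axis / enorm z.1 * (1 - cos u).

Definition lagrange_g (u : R) : R :=
  dotv z.1 z.2 / kfreq ^+ 2 * (1 - cos u) + enorm z.1 / kfreq * sin u.

Definition orbit_pos (u : R) : 'rV[R]_d :=
  lagrange_f u *: z.1 + lagrange_g u *: z.2.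

Definition orbit_rad (u : R) : R :=
  semi_axis + (enorm z.1 - semi_axis) * cos u + dotv z.1 z.2 / kfreq * sin u.

(** Kepler's equation, with time and anomaly counted from the initial point instead of the
    pericenter. *)
Definition orbit_time (u : R) : R :=
  (semi_axis * u + (enorm z.1 - semi_axis) * sin u
   + dotv z.1 z.2 / kfreq * (1 - cos u)) / kfreq.

(** The coefficients are the [u]-derivatives of [lagrange_f] and [lagrange_g], multiplied by
    [du/dt = kfreq / orbit_rad]. *)
Definition orbit_vel (u : R) : 'rV[R]_d :=
  (- (semi_axis * kfreq / enorm z.1 * sin u) / orbit_rad u) *: z.1
  + ((dotv z.1 z.2 / kfreq * sin u + enorm z.1 * cos u) / orbit_rad u) *: z.2.

End OrbitDefs.

Section Orbit.
Context {R : realType} {d : nat} (m1 : R) (z : 'rV[R]_d * 'rV[R]_d).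
Hypothesis m1_gt0 : 0 < m1.
Hypothesis E_lt0 : E_Kep m1 z < 0.
Hypothesis C_gt0 : 0 < sq_ang_mom z.

Local Notation r := (enorm z.1).
Local Notation s := (dotv z.1 z.2).
Local Notation n := (dotv z.2 z.2).
Local Notation w := (kfreq m1 z).
Local Notation rho := (semi_axis m1 z).
Local Notation rad := (orbit_rad m1 z).
Local Notation time := (orbit_time m1 z).

Lemma sq_ang_mom_gt0_neq0 : z.1 != 0.
Proof.
apply/negP => /eqP q0; move: C_gt0.
by rewrite /sq_ang_mom !enorm_sqr q0 !dotv0l mul0r expr0n subr0 ltxx.
Qed.
Local Notation q_neq0 := sq_ang_mom_gt0_neq0.

Lemma kfreq_arg_gt0 : 0 < 2 * m1 / r - n.
Proof. by move: E_lt0; rewrite /E_Kep enorm_sqr; lra. Qed.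

Lemma kfreq_gt0 : 0 < w.
Proof. by rewrite sqrtr_gt0 kfreq_arg_gt0. Qed.

Lemma kfreq_sqr : w ^+ 2 = 2 * m1 / r - n.
Proof. by rewrite sqr_sqrtr// ltW// kfreq_arg_gt0. Qed.

Lemma semi_axis_gt0 : 0 < rho.
Proof. by rewrite divr_gt0// exprn_gt0// kfreq_gt0. Qed.

Lemma m1E : m1 = rho * w ^+ 2.
Proof. by rewrite /semi_axis divfK// expf_neq0// lt0r_neq0// kfreq_gt0. Qed.

(** The vis-viva equation. Eliminating [n] with it leaves [r], [s], [w] and [rho] as independent
    quantities, so that orbit identities become accessible to [field]. *)
Lemma dotv_vvE : n = w ^+ 2 * (2 * rho / r - 1).
Proof.
have -> : n = 2 * m1 / r - w ^+ 2 by rewrite kfreq_sqr; ring.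
by rewrite {1}m1E; field; exact: enorm_neq0 q_neq0.
Qed.

(** The radius is [rho] plus a harmonic of amplitude [sqrt (b^2 + c^2)], and [rho^2 - (b^2 + c^2)]
    equals the squared angular momentum over [w^2], which is positive: the eccentricity is below
    one. *)
Lemma orbit_rad_gt0 u : 0 < rad u.
Proof.
have r0 := enorm_neq0 q_neq0; have w0 := lt0r_neq0 kfreq_gt0.
have rho0 := semi_axis_gt0.
set b := r - rho; set c := s / w.
have bc : b ^+ 2 + c ^+ 2 < rho ^+ 2.
  rewrite -subr_gt0.
  have -> : rho ^+ 2 - (b ^+ 2 + c ^+ 2) = sq_ang_mom z / w ^+ 2.
    rewrite /b /c /sq_ang_mom !enorm_sqr dotv_vvE -(enorm_sqr z.1).
    by field; rewrite r0 w0.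
  by rewrite divr_gt0// exprn_gt0// kfreq_gt0.
(* Cauchy-Schwarz for [(b, c)] and [(cos u, sin u)], through Lagrange's identity. *)
have : (b * cos u + c * sin u) ^+ 2 < rho ^+ 2.
  apply: le_lt_trans bc.
  have -> : b ^+ 2 + c ^+ 2 = (b ^+ 2 + c ^+ 2) * (cos u ^+ 2 + sin u ^+ 2).
    by rewrite cos2Dsin2 mulr1.
  rewrite -subr_ge0.
  have -> : (b ^+ 2 + c ^+ 2) * (cos u ^+ 2 + sin u ^+ 2)
    - (b * cos u + c * sin u) ^+ 2 = (b * sin u - c * cos u) ^+ 2 by ring.
  exact: sqr_ge0.
set x := b * _ + _ => x2.
have rhox : - rho < x by rewrite ltNge; apply/negP => xr; nra.
by rewrite /orbit_rad -/b -/c -addrA -/x; lra.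
Qed.

Lemma dotv_orbit_pos u : dotv (orbit_pos m1 z u) (orbit_pos m1 z u) = rad u ^+ 2.
Proof.
have r0 := enorm_neq0 q_neq0; have w0 := lt0r_neq0 kfreq_gt0.
rewrite /orbit_pos !dotvE (dotvC z.2 z.1) dotv_vvE -(enorm_sqr z.1).
rewrite /lagrange_f /lagrange_g /orbit_rad.
have CS : sin u ^+ 2 = 1 - cos u ^+ 2 by rewrite sin2cos2.
by field: CS; rewrite w0 r0.
Qed.

Lemma orbit_time0 : time 0 = 0.
Proof. by rewrite /orbit_time sin0 cos0 subrr !mulr0 !addr0 mul0r. Qed.

Lemma orbit_time2pi : time (pi *+ 2) = 2 * pi * rho / w.
Proof.
by rewrite /orbit_time sin2pi cos2pi subrr !mulr0 !addr0; ring.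
Qed.

Lemma diff_along_orbit_time u : diff_along time u 1 (rad u / w).
Proof.
apply: diff_along_eq.
  apply: diff_along_mul; last exact: diff_along_cst.
  apply: diff_along_add; first apply: diff_along_add.
  - by apply: diff_along_mul; [exact: diff_along_cst|exact: diff_along_id].
  - by apply: diff_along_mul; [exact: diff_along_cst|exact: diff_along_sin].
  - apply: diff_along_mul; first exact: diff_along_cst.
    apply: diff_along_add; first exact: diff_along_cst.
    by apply: diff_along_opp; exact: diff_along_cos.
by rewrite /orbit_rad /=; ring.
Qed.

Lemma orbit_time_incr : {homo time : x y / x < y}.
Proof.
apply: diff_along_gt0_incr => [t|t]; first exact: diff_along_orbit_time.
by rewrite divr_gt0// ?kfreq_gt0// orbit_rad_gt0.
Qed.

Lemma orbit_time_lt : {mono time : x y / x < y}.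
Proof. exact: leW_mono (le_mono orbit_time_incr). Qed.

Lemma orbit_time_inj : injective time.
Proof. exact: inc_inj (le_mono orbit_time_incr). Qed.

Lemma continuous_orbit_time : continuous time.
Proof. move=> u; exact: diff_along_continuous (diff_along_orbit_time u). Qed.

(** [time u * w] stays within the constant [K] of [rho * u], so [time] takes values on both sides of
    [t] and the intermediate value theorem applies. *)
Lemma orbit_time_surj t : exists u, time u = t.
Proof.
have w0 := kfreq_gt0; have rho0 := semi_axis_gt0.
set K := `|r - rho| + 2 * `|s / w|.
have K0 : 0 <= K by rewrite addr_ge0// mulr_ge0.
have bnd u : `|time u * w - rho * u| <= K.
  rewrite /orbit_time divfK ?lt0r_neq0//.
  rewrite (_ : _ - _ = (r - rho) * sin u + s / w * (1 - cos u)); last by ring.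
  apply: le_trans (ler_normD _ _) _.
  rewrite (normrM (r - rho)) (normrM (s / w)).
  apply: lerD; first by rewrite ler_piMr// sin_max.
  rewrite [leLHS]mulrC ler_wpM2r// ler_norml.
  by have := cos_geN1 u; have := cos_le1 u; lra.
(* Chosen so that [rho * U] exceeds [|t| * w] by exactly the error bound [K]. *)
set U := (`|t| * w + K) / rho.
have U0 : 0 <= U by rewrite divr_ge0 ?(ltW rho0)// addr_ge0// mulr_ge0// ltW.
have UE : rho * U = `|t| * w + K by rewrite mulrC divfK// lt0r_neq0.
have cU : {within `[- U, U], continuous time}.
  by apply: continuous_subspaceT => x; exact: continuous_orbit_time.
have t_le : t <= time U.
  rewrite -(ler_pM2r w0); have := bnd U; rewrite UE ler_norml => /andP[H _].
  have : t * w <= `|t| * w by rewrite ler_pM2r// ler_norm.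
  by lra.
have le_t : time (- U) <= t.
  rewrite -(ler_pM2r w0); have := bnd (- U); rewrite mulrN UE ler_norml.
  move=> /andP[_ H].
  have : - `|t| * w <= t * w by rewrite ler_pM2r// lerNl -normrN ler_norm.
  by lra.
have UU : - U <= U by lra.
have [|u _ <-] := @IVT _ _ _ _ t UU cU; last by exists u.
by rewrite ge_min le_t le_max t_le orbT.
Qed.

End Orbit.

(** * Existence and uniqueness of the Kepler flow *)

Section KeplerFlow.
Context {R : realType} {d : nat} (m1 : R) (z : 'rV[R]_d * 'rV[R]_d).
Hypothesis m1_gt0 : 0 < m1.
Hypothesis E_lt0 : E_Kep m1 z < 0.
Hypothesis C_gt0 : 0 < sq_ang_mom z.

Local Notation r := (enorm z.1).
Local Notation s := (dotv z.1 z.2).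
Local Notation n := (dotv z.2 z.2).
Local Notation w := (kfreq m1 z).
Local Notation rho := (semi_axis m1 z).
Local Notation rad := (orbit_rad m1 z).
Local Notation time := (orbit_time m1 z).

Let q_neq0 : z.1 != 0 := sq_ang_mom_gt0_neq0 C_gt0.
Let w_gt0 : 0 < w := kfreq_gt0 E_lt0.
Let w_neq0 : w != 0 := lt0r_neq0 w_gt0.
Let r_neq0 : r != 0 := enorm_neq0 q_neq0.
Let rho_gt0 : 0 < rho := semi_axis_gt0 m1_gt0 E_lt0.

(** This is [w * rad u] with the division by [w] cleared, the shape in which [field] asks for a
    nonvanishing radius. *)
Let orbit_rad_num_neq0 u : (rho + (r - rho) * cos u) * w + s * sin u != 0.
Proof.
rewrite (_ : _ + _ = w * rad u); last by rewrite /orbit_rad; field.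
by rewrite mulf_neq0// lt0r_neq0// orbit_rad_gt0.
Qed.

Lemma diff_along_lagrange_f u :
  diff_along (lagrange_f m1 z) u 1 (- (rho / r * sin u)).
Proof.
apply: diff_along_eq.
  apply: diff_along_add; first exact: diff_along_cst.
  apply: diff_along_opp; apply: diff_along_mul; first exact: diff_along_cst.
  apply: diff_along_add; first exact: diff_along_cst.
  by apply: diff_along_opp; exact: diff_along_cos.
by rewrite /=; ring.
Qed.

Lemma diff_along_lagrange_g u :
  diff_along (lagrange_g m1 z) u 1 (s / w ^+ 2 * sin u + r / w * cos u).
Proof.
apply: diff_along_eq.
  apply: diff_along_add.
    apply: diff_along_mul; first exact: diff_along_cst.
    apply: diff_along_add; first exact: diff_along_cst.
    by apply: diff_along_opp; exact: diff_along_cos.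
  by apply: diff_along_mul; [exact: diff_along_cst|exact: diff_along_sin].
by rewrite /=; ring.
Qed.

Lemma diff_along_orbit_rad u :
  diff_along rad u 1 (s / w * cos u - (r - rho) * sin u).
Proof.
apply: diff_along_eq.
  apply: diff_along_add; first apply: diff_along_add.
  - exact: diff_along_cst.
  - by apply: diff_along_mul; [exact: diff_along_cst|exact: diff_along_cos].
  - by apply: diff_along_mul; [exact: diff_along_cst|exact: diff_along_sin].
by rewrite /=; ring.
Qed.

Lemma enorm_orbit_pos u : enorm (orbit_pos m1 z u) = rad u.
Proof.
rewrite /enorm dotv_orbit_pos// sqrtr_sqr gtr0_norm//.
exact: orbit_rad_gt0.
Qed.

Lemma orbit_pos_neq0 u : orbit_pos m1 z u != 0.
Proof.
rewrite -dotv_eq0 dotv_orbit_pos// expf_neq0// lt0r_neq0//.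
exact: orbit_rad_gt0.
Qed.

(** Kepler's equation is inverted to express the anomaly by time, and the explicit orbit is then
    checked against Newton's equation. Without a global solution the choice in [kepler_flow] would
    be arbitrary. *)
Lemma kepler_solution_exists :
  exists g, kepler_solution m1 setT g /\ g 0 = z.
Proof.
have [U timeU] := choice (orbit_time_surj m1_gt0 E_lt0).
have Utime : cancel time U.
  by move=> u; apply: (orbit_time_inj m1_gt0 E_lt0 C_gt0); rewrite timeU.
have U0 : U 0 = 0 by rewrite -{1}(orbit_time0 m1 z) Utime.
have dU t : diff_along U t 1 (w / rad (U t)).
  apply: is_derive_diff_along.
  have R0 := lt0r_neq0 (orbit_rad_gt0 m1_gt0 E_lt0 C_gt0 (U t)).
  (* The point is rewritten as [time (U t)] and the value as the inverse of [rad / w], to match the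
     rule for inverse functions. *)
  rewrite -[X in is_derive X _ _ _]timeU -invf_div.
  apply: (@is_derive_inverse _ time).
  - by near=> x; exact: Utime.
  - by near=> x; exact: continuous_orbit_time.
  - by apply: diff_along_is_derive; exact: diff_along_orbit_time.
  - by rewrite mulf_neq0// invr_neq0.
exists (fun t => (orbit_pos m1 z (U t), orbit_vel m1 z (U t))); split; last first.
  rewrite U0 /orbit_pos /orbit_vel /lagrange_f /lagrange_g /orbit_rad.
  rewrite sin0 cos0 !subrr !mulr0 !subr0 !addr0 mulr1 add0r.
  rewrite mulr1 oppr0 mul0r !scale0r scale1r addr0 add0r (addrC rho) subrK.
  by rewrite divff// scale1r; case: (z).
move=> t _ /=; split; first exact: orbit_pos_neq0.
rewrite ham_field_E_Kep/=; last exact: orbit_pos_neq0.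
have R0 := lt0r_neq0 (orbit_rad_gt0 m1_gt0 E_lt0 C_gt0 (U t)).
have dcomp (f : R -> R) (l : R) : diff_along f (U t) 1 l ->
    diff_along (fun x => f (U x)) t 1 (l * (w / rad (U t))).
  by move=> df; apply: diff_along_comp; [exact: dU|exact: diff_along_is_derive].
apply: is_derive_curve => i /=.
  rewrite (_ : (fun x => _) = fun x => lagrange_f m1 z (U x) * z.1 0 i
    + lagrange_g m1 z (U x) * z.2 0 i); last by apply/funext => x; rewrite !mxE.
  apply: diff_along_eq.
    apply: diff_along_add.
      apply: diff_along_mul; last exact: diff_along_cst.
      by apply: dcomp; exact: diff_along_lagrange_f.
    apply: diff_along_mul; last exact: diff_along_cst.
    by apply: dcomp; exact: diff_along_lagrange_g.
  by rewrite !mxE; field; rewrite R0 w_neq0 r_neq0.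
rewrite enorm_orbit_pos (_ : m1 / _ = rho * w ^+ 2 / rad (U t) ^+ 3); last first.
  by rewrite -(m1E E_lt0).
(* [X] and [Y] are the coefficients of the initial position and velocity in [orbit_vel]. *)
pose X u := - (rho * w / r * sin u) / rad u.
pose Y u := (s / w * sin u + r * cos u) / rad u.
rewrite (_ : (fun x => _) = fun x => X (U x) * z.1 0 i
    + Y (U x) * z.2 0 i); last by apply/funext => x; rewrite !mxE.
have dV u : diff_along (fun u => (rad u)^-1) u 1
    (- (rad u)^-2 * (s / w * cos u - (r - rho) * sin u)).
  apply: diff_along_inv; last exact: diff_along_orbit_rad.
  exact/lt0r_neq0/orbit_rad_gt0.
have dX := dcomp _ _ (diff_along_mul (diff_along_opp
  (diff_along_mul (diff_along_cst (rho * w / r) (U t) (1 : R))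
     (diff_along_sin (U t)))) (dV (U t))).
have dY := dcomp _ _ (diff_along_mul (diff_along_add
  (diff_along_mul (diff_along_cst (s / w) (U t) (1 : R)) (diff_along_sin (U t)))
  (diff_along_mul (diff_along_cst r (U t) (1 : R)) (diff_along_cos (U t))))
  (dV (U t))).
apply: diff_along_eq.
  by apply: diff_along_add; (apply: diff_along_mul; last exact: diff_along_cst);
    [exact: dX|exact: dY].
rewrite !mxE /lagrange_f /lagrange_g.
have CS : sin (U t) ^+ 2 = 1 - cos (U t) ^+ 2 by rewrite sin2cos2.
rewrite /= -/(orbit_rad m1 z (U t)).
move: R0; rewrite /X /Y /orbit_rad => R0.
have R1 := orbit_rad_num_neq0 (U t).
by field: CS; rewrite R1 w_neq0 r_neq0.
Unshelve. all: by end_near. Qed.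

(** * Every global solution is the explicit orbit *)

Section Uniqueness.
Variable g : R -> 'rV[R]_d * 'rV[R]_d.
Hypothesis g_sol : kepler_solution m1 setT g.
Hypothesis g0 : g 0 = z.

Local Notation q t := (g t).1.
Local Notation v t := (g t).2.
Local Notation rt t := (enorm (g t).1).
Local Notation st t := (dotv (g t).1 (g t).2).

Let qt_neq0 t : q t != 0.
Proof. by have [] := g_sol (I : setT t). Qed.

Let rt_neq0 t : rt t != 0.
Proof. exact/enorm_neq0/qt_neq0. Qed.

(** Conservation of energy, solved for the squared speed. *)
Let E_cst t : dotv (v t) (v t) = 2 * m1 / rt t - w ^+ 2.
Proof.
have : E_Kep m1 (g t) = E_Kep m1 (g 0).
  apply: (@diff_along0_cst _ (fun t => E_Kep m1 (g t))) => x.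
  have [_ dg] := g_sol (I : setT x).
  apply: diff_along_eq (diff_along_curve dg (diff_along_E_Kep _ _ _)) _.
    exact: qt_neq0.
  rewrite ham_field_E_Kep; last exact: qt_neq0.
  by rewrite /= dotvZr (dotvC (v x)); ring.
rewrite g0 kfreq_sqr// /E_Kep !enorm_sqr => H.
by lra.
Qed.

Let dq t i : diff_along (fun x => q x 0 i) t 1 (v t 0 i).
Proof. exact: (kepler_solution_q _ g_sol). Qed.

Let dv t i : diff_along (fun x => v x 0 i) t 1
  ((- (m1 / rt t ^+ 3) *: q t) 0 i).
Proof. exact: (kepler_solution_v _ g_sol). Qed.

Let dr t : diff_along (fun x => rt x) t 1 (st t / rt t).
Proof. exact: (@diff_along_enorm _ _ _ (fun x => q x) t 1 _ (qt_neq0 t) (dq t)). Qed.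

(** By Newton's equation the derivative of [q . v] is [v . v - m1 / r]; conservation of energy
    removes the squared speed. *)
Let ds t : diff_along (fun x => st x) t 1 (m1 / rt t - w ^+ 2).
Proof.
apply: diff_along_eq.
  exact: (@diff_along_dotv _ _ _ (fun x => q x) (fun x => v x) t 1 _ _
    (dq t) (dv t)).
by rewrite dotvZr E_cst -enorm_sqr; field; exact: rt_neq0.
Qed.

(* Eccentric anomaly of an arbitrary solution, read off Kepler's equation; no
   integration of [w / rt] is needed. *)
Let th t := (w ^+ 3 * t + w * (st t - s)) / m1.

Let m1_neq0 : m1 != 0 := lt0r_neq0 m1_gt0.

Let dth t : diff_along th t 1 (w / rt t).
Proof.
apply: diff_along_eq.
  apply: diff_along_mul; last exact: diff_along_cst.
  apply: diff_along_add.
    by apply: diff_along_mul; [exact: diff_along_cst|exact: diff_along_id].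
  apply: diff_along_mul; first exact: diff_along_cst.
  by apply: diff_along_add; [exact: ds|exact: diff_along_cst].
by rewrite /=; field; rewrite rt_neq0 m1_neq0.
Qed.

Let th0 : th 0 = 0.
Proof. by rewrite /th g0 subrr !mulr0 addr0 mul0r. Qed.

(** Since [m1 = rho * w^2], the pair [(rt - rho, st / w)] rotates with angular velocity [w / rt],
    which is the derivative of [th]. *)
Let rad_th t :
  rt t - rho = (r - rho) * cos (th t) + s / w * sin (th t) /\
  st t / w = s / w * cos (th t) - (r - rho) * sin (th t).
Proof.
have := @rotation_solution _ (fun x => rt x - rho) (fun x => st x / w)
  th (fun x => w / rt x) _ _ dth th0 t.
rewrite /= !g0; apply => x.
  apply: diff_along_eq.
    by apply: diff_along_add; [exact: dr|exact: diff_along_cst].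
  by rewrite /=; field; rewrite rt_neq0 w_neq0.
apply: diff_along_eq.
  by apply: diff_along_mul; [exact: ds|exact: diff_along_cst].
by have m1w := m1E E_lt0; rewrite /=; field: m1w; rewrite rt_neq0 w_neq0.
Qed.

(* [W] is the position relative to the center of the ellipse and [P] its
   derivative in the eccentric anomaly, so that the pair rotates. *)
Let pos_th t i :
  let W x := rho / rt x * q x 0 i - st x / w ^+ 2 * v x 0 i in
  let P x := rt x / w * v x 0 i in
  [/\ W t = W 0 * cos (th t) + P 0 * sin (th t),
      P t = P 0 * cos (th t) - W 0 * sin (th t)
    & q t 0 i - W t = q 0 0 i - W 0].
Proof.
move=> W P; have m1w := m1E E_lt0.
have dW x : diff_along W x 1 (v x 0 i).
  apply: diff_along_eq.
    apply: diff_along_add.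
      apply: diff_along_mul; last exact: dq.
      apply: diff_along_mul; first exact: diff_along_cst.
      by apply: diff_along_inv; [exact: rt_neq0|exact: dr].
    apply: diff_along_opp; apply: diff_along_mul; last exact: dv.
    by apply: diff_along_mul; [exact: ds|exact: diff_along_cst].
  by rewrite mxE /=; field: m1w; rewrite rt_neq0 w_neq0.
have dP x : diff_along P x 1 (- (w / rt x * W x)).
  apply: diff_along_eq.
    apply: diff_along_mul; last exact: dv.
    by apply: diff_along_mul; [exact: dr|exact: diff_along_cst].
  by rewrite mxE /= /W; field: m1w; rewrite rt_neq0 w_neq0.
have dW' x : diff_along W x 1 (w / rt x * P x).
  apply: diff_along_eq (dW x) _.
  by rewrite /P; field; rewrite rt_neq0 w_neq0.
have [WE PE] := rotation_solution dW' dP dth th0 t.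
split=> //.
(* Both [q] and [W] have derivative [v], so the center of the ellipse is fixed. *)
apply: (@diff_along0_cst _ (fun x => q x 0 i - W x)) => x.
apply: diff_along_eq.
  by apply: diff_along_add; [exact: dq|apply: diff_along_opp; exact: dW].
by rewrite subrr.
Qed.

(** The definition of [th] contains [st t], whereas [orbit_time] contains trigonometric terms; the
    second formula of [rad_th] trades one for the other. *)
Let time_th t : time (th t) = t.
Proof.
have [_ sE] := rad_th t.
rewrite /orbit_time.
have -> : (r - rho) * sin (th t) = s / w * cos (th t) - st t / w.
  by rewrite sE; ring.
by have m1w := m1E E_lt0; rewrite {1}/th; field: m1w; rewrite w_neq0.
Qed.

(** Injectivity of [time] identifies [th] at time [time u] with [u]; then [q] is the fixed center
    plus [W], and [v] is recovered from [P]. Hence any solution that [kepler_flow] may select is the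
    explicit one. *)
Lemma kepler_solution_orbit u : g (time u) = (orbit_pos m1 z u, orbit_vel m1 z u).
Proof.
have thE : th (time u) = u.
  exact: (orbit_time_inj m1_gt0 E_lt0 C_gt0 (time_th _)).
have [rE _] := rad_th (time u); rewrite thE in rE.
have {}rE : rt (time u) = rad u by rewrite /orbit_rad -addrA -rE addrC subrK.
have R0 := lt0r_neq0 (orbit_rad_gt0 m1_gt0 E_lt0 C_gt0 u).
rewrite [LHS]surjective_pairing; congr (_, _); apply/rowP => i.
all: have := pos_th (time u) i => /=; rewrite thE rE !g0 => -[WE PE qE].
  rewrite !mxE; rewrite WE in qE.
  transitivity (z.1 0 i - (rho / r * z.1 0 i - s / w ^+ 2 * z.2 0 i) +
   ((rho / r * z.1 0 i - s / w ^+ 2 * z.2 0 i) * cos u +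
       r / w * z.2 0 i * sin u)).
    by rewrite -qE subrK.
  by rewrite /lagrange_f /lagrange_g; ring.
rewrite !mxE -[LHS](mulKf (_ : rad u / w != 0)); last first.
  by rewrite mulf_neq0// invr_neq0.
rewrite PE; have := orbit_rad_num_neq0 u; move: R0; rewrite /orbit_rad => R0 R1.
by field; rewrite R1 w_neq0 r_neq0.
Qed.

End Uniqueness.

End KeplerFlow.

(** * Period and average *)

Section Average.
Context {R : realType} {d : nat} (m1 : R) (z : 'rV[R]_d * 'rV[R]_d).
Hypothesis m1_gt0 : 0 < m1.
Hypothesis E_lt0 : E_Kep m1 z < 0.
Hypothesis C_gt0 : 0 < sq_ang_mom z.

Local Notation r := (enorm z.1).
Local Notation s := (dotv z.1 z.2).
Local Notation n := (dotv z.2 z.2).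
Local Notation w := (kfreq m1 z).
Local Notation rho := (semi_axis m1 z).
Local Notation rad := (orbit_rad m1 z).
Local Notation time := (orbit_time m1 z).
Local Notation flow := (kepler_flow m1 z).

Let q_neq0 : z.1 != 0 := sq_ang_mom_gt0_neq0 C_gt0.
Let w_gt0 : 0 < w := kfreq_gt0 E_lt0.
Let r_gt0 : 0 < r := enorm_gt0 q_neq0.
Let rho_gt0 : 0 < rho := semi_axis_gt0 m1_gt0 E_lt0.

Lemma kepler_flowP : kepler_solution m1 setT flow /\ flow 0 = z.
Proof. exact: (getPex (kepler_solution_exists m1_gt0 E_lt0 C_gt0)). Qed.

Lemma kepler_flow_orbit u : flow (time u) = (orbit_pos m1 z u, orbit_vel m1 z u).
Proof. by have [fs f0] := kepler_flowP; exact: kepler_solution_orbit. Qed.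

(** Nonzero angular momentum makes [q] and [v] independent, so returning to [q] forces the
    coefficient [lagrange_f] to be one. *)
Lemma orbit_pos_period u : orbit_pos m1 z u = z.1 -> cos u = 1.
Proof.
rewrite /orbit_pos => H.
(* The vector [n q - s v] is orthogonal to [v] and pairs with [q] to the squared angular momentum,
   so it isolates the coefficient of [q]. *)
have {}H : dotv (lagrange_f m1 z u *: z.1 + lagrange_g m1 z u *: z.2)
    (n *: z.1 - s *: z.2) = dotv z.1 (n *: z.1 - s *: z.2) by rewrite H.
have : (lagrange_f m1 z u - 1) * sq_ang_mom z = 0.
  move/eqP: H; rewrite -subr_eq0 !dotvE (dotvC z.2 z.1) => /eqP <-.
  by rewrite /sq_ang_mom !enorm_sqr; ring.
move/eqP; rewrite mulf_eq0 (gt_eqF C_gt0) orbF /lagrange_f.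
rewrite (_ : _ - _ = rho / r * (cos u - 1)); last by ring.
by rewrite mulf_eq0 (gt_eqF (divr_gt0 rho_gt0 r_gt0)) subr_eq0 => /eqP.
Qed.

Lemma cos_lt1 (u : R) : 0 < u < pi *+ 2 -> cos u != 1.
Proof.
move=> /andP[u0 u2]; apply/negP => /eqP cu.
have su : 0 < sin (u / 2).
  by apply: sin_gt0_pi; rewrite divr_gt0//= ltr_pdivrMr// mulr_natr.
have := cos_mulr2n (u / 2); rewrite -(mulr_natr (u / 2)) divfK// cu => cu2.
have := cos2Dsin2 (u / 2); have : 0 < sin (u / 2) ^+ 2 by rewrite exprn_gt0.
by lra.
Qed.

Lemma kepler_periodE : kepler_period m1 z = time (pi *+ 2).
Proof.
have [_ f0] := kepler_flowP.
have pi2 : 0 < pi *+ 2 :> R by rewrite mulrn_wgt0// pi_gt0.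
have T0 : 0 < time (pi *+ 2).
  by rewrite -[X in X < _](orbit_time0 m1 z); exact: orbit_time_incr.
have inT : [set T : R | 0 < T /\ flow T = z] (time (pi *+ 2)).
  split=> //; rewrite -[RHS]f0 -(orbit_time0 m1 z) !kepler_flow_orbit.
  rewrite /orbit_pos /orbit_vel /lagrange_f /lagrange_g /orbit_rad.
  by rewrite sin2pi cos2pi sin0 cos0.
apply/eqP; rewrite eq_le; apply/andP; split.
  by apply: ge_inf => //; exists 0 => x [/ltW].
apply: lb_le_inf; first by exists (time (pi *+ 2)).
move=> T [T_gt0 fT]; rewrite leNgt; apply/negP => T_lt.
have [u uT] := orbit_time_surj m1_gt0 E_lt0 T.
move: T_gt0 T_lt; rewrite -uT -{1}(orbit_time0 m1 z).
rewrite !(orbit_time_lt m1_gt0 E_lt0 C_gt0) => u0 u2.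
(* A smaller period would be [time u] with [0 < u < 2 pi]; the return of the position alone gives
   [cos u = 1], a contradiction. *)
have /negP[] := cos_lt1 (introT andP (conj u0 u2)).
have := kepler_flow_orbit u; rewrite uT fT => /(congr1 fst) zE.
by apply/eqP/orbit_pos_period/esym; exact: zE.
Qed.

(** Serves as the continuity of the integrand in time, required by the change of variables. *)
Lemma diff_along_V_flow a m2 t : (flow t).1 != center2 d a ->
  exists l, diff_along (fun x => V_Eucl2 a m2 (flow x).1) t 1 l.
Proof.
move=> ft; have [fs _] := kepler_flowP.
eexists; apply: diff_along_opp; apply: diff_along_mul; first exact: diff_along_cst.
have ft' : (flow t).1 - center2 d a != 0 by rewrite subr_eq0.
apply: diff_along_inv; first exact: enorm_neq0.
apply: (@diff_along_enorm _ _ _ (fun x => (flow x).1 - center2 d a) _ _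
  (flow t).2) => // i.
rewrite (_ : (fun x => _) = fun x => (flow x).1 0 i + (- center2 d a 0 i)).
  apply: diff_along_eq.
    apply: diff_along_add; first exact: (kepler_solution_q i fs (I : setT t)).
    exact: diff_along_cst.
  by rewrite addr0.
by apply/funext => x; rewrite !mxE.
Qed.

(** Substitution [t = orbit_time u], with [dt = (rad u / w) du]. The center is to be avoided on one
    period only: for points near a given one, this is what a compactness argument provides. *)
Lemma V_avgE a m2 :
  (forall u, u \in `[0, pi *+ 2] -> orbit_pos m1 z u != center2 d a) ->
  V_avg a m1 m2 z = (2 * pi * rho / w)^-1 *
    (\int[@lebesgue_measure R]_(u in `[0, pi *+ 2])
       (V_Eucl2 a m2 (orbit_pos m1 z u) * (rad u / w)))%R.
Proof.
move=> pos_neq; rewrite /V_avg kepler_periodE -orbit_time2pi; congr (_ * fine _).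
have pi2 : 0 <= pi *+ 2 :> R by rewrite mulrn_wge0// pi_ge0.
have dtime : derive1 time = fun u => rad u / w.
  apply/funext => u; rewrite derive1E.
  by have [_ ->] := diff_along_is_derive (diff_along_orbit_time m1 z u).
have crad : continuous (fun u => rad u / w).
  move=> u; apply: (@diff_along_continuous _ (fun u => rad u / w)).
  by apply: diff_along_mul; [exact: diff_along_orbit_rad|exact: diff_along_cst].
have ctime := @continuous_orbit_time _ _ m1 z.
have := @integration_by_substitution_increasing _ time
  (fun t => V_Eucl2 a m2 (flow t).1) 0 (pi *+ 2) pi2.
rewrite orbit_time0 => ->.
- apply: eq_integral => u _ /=; congr (_%:E).
  by rewrite dtime !fctE /= kepler_flow_orbit.
- by move=> x y _ _; exact: orbit_time_incr.
- by move=> x _; rewrite dtime; exact: crad.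
- by rewrite dtime; apply/cvg_ex; exists (rad 0 / w); apply: cvg_at_right_filter; exact: crad.
- by rewrite dtime; apply/cvg_ex; exists (rad (pi *+ 2) / w); apply: cvg_at_left_filter; exact: crad.
- split.
  + move=> u _.
    by have [] := diff_along_is_derive (diff_along_orbit_time m1 z u).
  + by apply: cvg_at_right_filter; exact: ctime.
  + by apply: cvg_at_left_filter; exact: ctime.
- apply: continuous_in_subspaceT => t; rewrite inE/= in_itv/= => /andP[t0 t2].
  have [u uT] := orbit_time_surj m1_gt0 E_lt0 t.
  have [|l dV] := @diff_along_V_flow a m2 t.
    rewrite -uT kepler_flow_orbit; apply: pos_neq; rewrite in_itv/=.
    have le_time := le_mono (orbit_time_incr m1_gt0 E_lt0 C_gt0).
    by rewrite -(le_time 0 u) -(le_time u) uT orbit_time0 t0 t2.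
  exact: diff_along_continuous dV.
Qed.

End Average.

(** * Differentiation under the integral *)

(** The differential is recognized from a candidate [L]: the norm bound makes the linear map
    continuous, and the remainder estimate makes it the derivative. *)
Lemma diff_along_of_bound (R : realType) (V : normedModType R) (F L : V -> R)
    (z X : V) (M : R) : linear L -> (forall h, `|L h| <= M * `|h|) ->
  (forall e, 0 < e -> \forall h \near (0 : V),
     `|F (h + z) - F z - L h| <= e * `|h|) ->
  diff_along F z X (L X).
Proof.
move=> lL bL rem.
pose LM := GRing.isLinear.Build _ _ _ _ _ (lL : linear (L : V -> R^o)).
pose LL : {linear V -> R} := HB.pack L LM.
have cL : continuous LL.
  apply: bounded_linear_continuous; rewrite /bounded_near.
  near=> K; apply/nbhs_ballP; exists 1 => //= h.
  rewrite -ball_normE /= sub0r normrN => h1.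
  apply: le_trans (bL h) _; apply: (@le_trans _ _ `|M|).
    rewrite -[leRHS]mulr1; apply: le_trans (ler_norm _) _.
    by rewrite normrM normr_id ler_wpM2l// ltW.
  by near: K; apply: nbhs_pinfty_ge; rewrite num_real.
have eF : F \o shift z = cst (F z) + LL +o_ 0 id.
  apply/eqaddoP => e e0; apply: filterS (rem _ e0) => h.
  by rewrite !fctE /= opprD addrA.
have dF : 'd F z = LL :> (V -> R) by exact: diff_unique.
split; last by rewrite dF.
by apply/diff_locallyP; rewrite dF.
Unshelve. all: by end_near. Qed.

(** Differentiability at [z] with a remainder uniform over the parameters in [I]. The common bound
    [M] on values and differentials makes the notion stable under products; continuity in the
    parameter, of [f w] for [w] near [z] and of [L], makes the integrals exist. *)
Definition unif_differentiable (R : realType) (V : normedModType R) (I : set R)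
    (f : V -> R -> R) (z : V) : Prop :=
  exists (L : R -> V -> R) (M : R),
  [/\ 0 < M,
      forall u, I u -> linear (L u) /\
        (`|f z u| <= M /\ forall h, `|L u h| <= M * `|h|),
      forall e, 0 < e -> \forall h \near (0 : V), forall u, I u ->
        `|f (h + z) u - f z u - L u h| <= e * `|h|,
      \forall w \near z, forall u, I u -> {for u, continuous (f w)}
    & forall h u, I u -> {for u, continuous (L^~ h)}].

Section UniformDifferentiability.
Context {R : realType} {V : normedModType R} (I : set R) (z : V).
Implicit Types (f g : V -> R -> R).

Lemma unif_differentiable_cst (a : V -> R) :
  differentiable a z -> unif_differentiable I (fun w _ => a w) z.
Proof.
move=> da; have [cd rem] := (diff_locallyxP _ _).1 da.
have [k k0 bk] := linear_lipschitz cd.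
exists (fun _ h => 'd a z h), (k + `|a z| + 1); split.
- by rewrite ltr_wpDl// addr_ge0// ltW.
- move=> u _; split; first by move=> c x y; rewrite linearP.
  split; first by have := normr_ge0 (a z); lra.
  move=> h; apply: le_trans (bk h) _; rewrite ler_wpM2r//.
  by have := normr_ge0 (a z); lra.
- move=> e e0; have /diff_locallyP[_ /eqaddoP/(_ _ e0)] := da.
  by apply: filterS => h + u _; rewrite !fctE /= opprD addrA.
- by near=> w => u _; exact: cst_continuous.
- by move=> h u _; exact: cst_continuous.
Unshelve. all: by end_near. Qed.

Lemma unif_differentiable_param (p : R -> R) (M : R) :
  (forall u, I u -> `|p u| <= M) -> (forall u, I u -> {for u, continuous p}) ->
  unif_differentiable I (fun _ u => p u) z.
Proof.
move=> pM cp; exists (fun _ _ => 0), (`|M| + 1); split.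
- by rewrite ltr_wpDl.
- move=> u Iu; split; first by move=> c x y; rewrite scaler0 addr0.
  split.
    by apply: le_trans (pM u Iu) _; have := ler_norm M; lra.
  by move=> h; rewrite normr0 mulr_ge0// addr_ge0.
- move=> e e0; near=> h => u Iu.
  by rewrite subrr subr0 normr0 mulr_ge0// ltW.
- by near=> w => u Iu; exact: cp.
- by move=> h u _; exact: cst_continuous.
Unshelve. all: by end_near. Qed.

Lemma unif_differentiable_add f g : unif_differentiable I f z ->
  unif_differentiable I g z ->
  unif_differentiable I (fun w u => f w u + g w u) z.
Proof.
move=> [Lf [Mf [Mf0 bf rf cf cLf]]] [Lg [Mg [Mg0 bg rg cg cLg]]].
exists (fun u h => Lf u h + Lg u h), (Mf + Mg); split.
- exact: addr_gt0.
- move=> u Iu; have [lf [fM Lfh]] := bf u Iu; have [lg [gM Lgh]] := bg u Iu.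
  split; first by move=> c x y; rewrite lf lg scalerDr addrACA.
  split; first by rewrite (le_trans (ler_normD _ _))// lerD.
  by move=> h; rewrite (le_trans (ler_normD _ _))// mulrDl lerD.
- move=> e e0; have e20 : 0 < e / 2 by rewrite divr_gt0.
  apply: filterS2 (rf _ e20) (rg _ e20) => h Hf Hg u Iu.
  rewrite (_ : _ - _ = (f (h + z) u - f z u - Lf u h) +
                       (g (h + z) u - g z u - Lg u h)); last by ring.
  rewrite (le_trans (ler_normD _ _))// [e]splitr mulrDl.
  by rewrite lerD ?Hf ?Hg.
- apply: filterS2 cf cg => w Hf Hg u Iu.
  by apply: continuousD; [exact: Hf|exact: Hg].
- by move=> h u Iu; apply: continuousD; [exact: cLf|exact: cLg].
Qed.

(** The remainder estimate with [e = 1] adds one to the bound [M] of the linear part. *)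
Lemma unif_differentiable_lipschitz f (L : R -> V -> R) (M : R) : 0 < M ->
  (forall u, I u -> forall h, `|L u h| <= M * `|h|) ->
  (forall e, 0 < e -> \forall h \near (0 : V), forall u, I u ->
    `|f (h + z) u - f z u - L u h| <= e * `|h|) ->
  \forall h \near (0 : V), forall u, I u ->
    `|f (h + z) u - f z u| <= (M + 1) * `|h|.
Proof.
move=> M0 bL rem; apply: filterS (rem 1 ltr01) => h Hh u Iu.
rewrite -[X in `|X|](subrK (L u h)) (le_trans (ler_normD _ _))//.
by rewrite mulrDl addrC lerD ?bL ?Hh.
Qed.

Lemma near0_norm_le (e : R) : 0 < e -> \forall h \near (0 : V), `|h| <= e.
Proof.
move=> e0; near=> h; apply: ltW; near: h; apply/nbhs_ballP; exists e => //= h.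
by rewrite -ball_normE /= sub0r normrN.
Unshelve. all: by end_near. Qed.

Lemma unif_differentiable_mul f g : unif_differentiable I f z ->
  unif_differentiable I g z ->
  unif_differentiable I (fun w u => f w u * g w u) z.
Proof.
move=> [Lf [Mf [Mf0 bf rf cf cLf]]] [Lg [Mg [Mg0 bg rg cg cLg]]].
exists (fun u h => f z u * Lg u h + g z u * Lf u h), (Mf * Mg *+ 2); split.
- by rewrite mulrn_wgt0// mulr_gt0.
- move=> u Iu; have [lf [fM Lfh]] := bf u Iu; have [lg [gM Lgh]] := bg u Iu.
  split.
    move=> c x y; rewrite lf lg -![_ *: _]/(_ * _); ring.
  split.
    rewrite normrM mulr2n; apply: le_trans (ler_pM _ _ fM gM) _ => //.
    by rewrite lerDl mulr_ge0// ltW.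
  move=> h; rewrite (le_trans (ler_normD _ _))// !normrM mulr2n mulrDl lerD//.
    by rewrite -mulrA ler_pM.
  by rewrite (mulrC Mf) -mulrA ler_pM.
- move=> e e0.
  have lipf := unif_differentiable_lipschitz Mf0 (fun u Iu => (bf u Iu).2.2) rf.
  have lipg := unif_differentiable_lipschitz Mg0 (fun u Iu => (bg u Iu).2.2) rg.
  (* The error splits into [f] times the remainder of [g], [g] times the remainder of [f], and the
     product of the increments; each gets a third of [e]. The last is quadratic in [h], so it is
     handled by the smallness [d] of [h]. *)
  pose ef := e / 3 / Mg; pose eg := e / 3 / Mf.
  have ef0 : 0 < ef by rewrite !divr_gt0.
  have eg0 : 0 < eg by rewrite !divr_gt0.
  pose d := e / 3 / ((Mf + 1) * (Mg + 1)).
  have MM : 0 < (Mf + 1) * (Mg + 1) by rewrite mulr_gt0// addr_gt0.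
  have d0 : 0 < d by rewrite !divr_gt0.
  apply: filterS2 (filterI (rf _ ef0) (rg _ eg0))
    (filterI (filterI lipf lipg) (near0_norm_le d0)).
  move=> h [Hf Hg] [[Hdf Hdg] Hh] u Iu.
  have {}Hf := Hf u Iu; have {}Hg := Hg u Iu.
  have {}Hdf := Hdf u Iu; have {}Hdg := Hdg u Iu.
  have [_ [fM _]] := bf u Iu; have [_ [gM _]] := bg u Iu.
  set df := f (h + z) u - f z u in Hf Hdf *.
  set dg := g (h + z) u - g z u in Hg Hdg *.
  rewrite (_ : _ - _ = f z u * (dg - Lg u h) + g z u * (df - Lf u h) + df * dg);
    last by rewrite /df /dg; ring.
  have -> : e * `|h| = e / 3 * `|h| + e / 3 * `|h| + e / 3 * `|h| by field.
  rewrite (le_trans (ler_normD _ _))// lerD//.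
    rewrite (le_trans (ler_normD _ _))// !normrM lerD//.
      apply: le_trans (ler_pM _ _ fM Hg) _ => //.
      by rewrite /eg mulrA mulrCA divff ?lt0r_neq0// mulr1.
    apply: le_trans (ler_pM _ _ gM Hf) _ => //.
    by rewrite /ef mulrA mulrCA divff ?lt0r_neq0// mulr1.
  rewrite normrM; apply: le_trans (ler_pM _ _ Hdf Hdg) _ => //.
  rewrite mulrACA mulrA ler_wpM2r//.
  apply: le_trans (ler_wpM2l (ltW MM) Hh) _.
  by rewrite /d mulrCA divff ?lt0r_neq0// mulr1.
- apply: filterS2 cf cg => w Hf Hg u Iu.
  by apply: continuousM; [exact: Hf|exact: Hg].
- move=> h u Iu; have cfz := nbhs_singleton cf u Iu; have cgz := nbhs_singleton cg u Iu.
  by apply: continuousD; apply: continuousM => //; [exact: cLg|exact: cLf].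
Qed.

Lemma unif_differentiable_near_gt f (e : R) : unif_differentiable I f z ->
  0 < e -> (forall u, I u -> e <= f z u) ->
  \forall h \near (0 : V), forall u, I u -> e / 2 <= f (h + z) u.
Proof.
move=> [L [M [M0 b r c cL]]] e0 fe.
have lip := unif_differentiable_lipschitz M0 (fun u Iu => (b u Iu).2.2) r.
have M10 : 0 < M + 1 by rewrite addr_gt0.
have d0 : 0 < e / 2 / (M + 1) by rewrite !divr_gt0.
apply: filterS2 lip (near0_norm_le d0) => h H1 H2 u Iu.
have := H1 u Iu; have := fe u Iu.
have : (M + 1) * `|h| <= e / 2 by rewrite mulrC -ler_pdivlMr.
by rewrite ler_norml => ? ? /andP[? ?]; lra.
Qed.


(** In terms of the roots [p], [q] of [x], [y] the remainder is an explicit positive multiple of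
    [(q^2 - p^2)^2]. Its coefficient is bounded by means of [2 p + q <= 2 (p + q)] and
    [c^5 <= p^3 q (p + q)]. *)
Lemma rsqrt_taylor (c x y : R) : 0 < c -> c ^+ 2 <= x -> c ^+ 2 <= y ->
  `|(Num.sqrt y)^-1 - (Num.sqrt x)^-1 + (y - x) / (2 * Num.sqrt x ^+ 3)|
  <= c ^- 5 * (y - x) ^+ 2.
Proof.
move=> c0 cx cy.
have sqrt_ge t : c ^+ 2 <= t -> c <= Num.sqrt t.
  by move=> ct; rewrite -(ger0_norm (ltW c0)) -sqrtr_sqr ler_wsqrtr.
have sqrtE t : c ^+ 2 <= t -> t = Num.sqrt t ^+ 2.
  by move=> ct; rewrite sqr_sqrtr// (le_trans (sqr_ge0 c)).
rewrite {2 4}(sqrtE _ cx) {2 3}(sqrtE _ cy).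
move: (Num.sqrt x) (Num.sqrt y) (sqrt_ge _ cx) (sqrt_ge _ cy) => p q cp cq.
have p0 := lt_le_trans c0 cp; have q0 := lt_le_trans c0 cq.
have pq0 : 0 < p + q by rewrite addr_gt0.
rewrite (_ : _ + _ = (2 * p + q) / (2 * p ^+ 3 * q * (p + q) ^+ 2)
                     * (q ^+ 2 - p ^+ 2) ^+ 2); last first.
  by field; rewrite !lt0r_neq0.
have D0 : 0 < 2 * p ^+ 3 * q * (p + q) ^+ 2.
  by rewrite !mulr_gt0// exprn_gt0.
rewrite ger0_norm; last first.
  rewrite mulr_ge0 ?sqr_ge0// divr_ge0// ltW// ?addr_gt0 ?mulr_gt0//.
rewrite ler_wpM2r ?sqr_ge0// ler_pdivrMr// [leRHS]mulrC ler_pdivlMr ?exprn_gt0//.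
have H : c ^+ 5 <= p ^+ 3 * q * (p + q).
  rewrite (_ : c ^+ 5 = c ^+ 3 * c * c); last by ring.
  have ce0 := ltW c0.
  have c3 : c ^+ 3 <= p ^+ 3 by rewrite lerXn2r// nnegrE ltW.
  have cpq : c <= p + q by rewrite (le_trans cp)// lerDl ltW.
  by rewrite !ler_pM// ?mulr_ge0// exprn_ge0.
rewrite (_ : 2 * p ^+ 3 * q * (p + q) ^+ 2 =
  (2 * (p + q)) * (p ^+ 3 * q * (p + q))); last by ring.
rewrite ler_pM//; last by lra.
- by rewrite ltW// addr_gt0// mulr_gt0.
- by rewrite exprn_ge0// ltW.
Qed.

Lemma unif_differentiable_rsqrt f (e : R) : unif_differentiable I f z ->
  0 < e -> (forall u, I u -> e <= f z u) ->
  unif_differentiable I (fun w u => (Num.sqrt (f w u))^-1) z.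
Proof.
move=> df e0 fe; have gef := unif_differentiable_near_gt df e0 fe.
have gef0 : \forall w \near z, forall u, I u -> 0 < f w u.
  rewrite (near_shift 0 z); apply: filterS gef => h H u Iu /=.
  by rewrite subr0; apply: lt_le_trans (H u Iu); rewrite divr_gt0.
have [L [M [M0 b r c cL]]] := df.
(* Near [z] the function stays above [e / 2], so [D] bounds its square root from below, uniformly in
   the parameter. *)
pose D := Num.sqrt (e / 2).
have D0 : 0 < D by rewrite sqrtr_gt0 divr_gt0.
have D2 : D ^+ 2 = e / 2 by rewrite sqr_sqrtr// divr_ge0// ltW.
have Df u : I u -> D ^+ 2 <= f z u.
  by move=> Iu; have := fe u Iu; rewrite D2; lra.
have Dsf u : I u -> D <= Num.sqrt (f z u).
  move=> Iu; rewrite -(ger0_norm (ltW D0)) -sqrtr_sqr ler_wsqrtr//; exact: Df.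
have dbound u : I u -> `|(2 * Num.sqrt (f z u) ^+ 3)^-1| <= D ^- 3.
  move=> Iu; have s0 := lt_le_trans D0 (Dsf u Iu).
  rewrite ger0_norm ?invr_ge0 ?mulr_ge0 ?exprn_ge0 ?(ltW s0)//.
  rewrite lef_pV2 ?posrE ?mulr_gt0 ?exprn_gt0//.
  have : D ^+ 3 <= Num.sqrt (f z u) ^+ 3.
    by rewrite lerXn2r ?nnegrE ?Dsf// ltW.
  have : 0 < D ^+ 3 by rewrite exprn_gt0.
  by lra.
have M1 : 0 <= D ^- 3 * M by rewrite mulr_ge0 ?invr_ge0 ?exprn_ge0// ltW.
have DV0 : 0 < D^-1 by rewrite invr_gt0.
exists (fun u h => - (2 * Num.sqrt (f z u) ^+ 3)^-1 * L u h), (D^-1 + D ^- 3 * M).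
split.
- by rewrite ltr_pwDl.
- move=> u Iu; have [lL [fM Lh]] := b u Iu; have s0 := lt_le_trans D0 (Dsf u Iu).
  split; first by move=> k x y; rewrite lL -![_ *: _]/(_ * _); ring.
  split.
    rewrite ger0_norm ?invr_ge0 ?(ltW s0)//.
    have : (Num.sqrt (f z u))^-1 <= D^-1 by rewrite lef_pV2 ?posrE// Dsf.
    by lra.
  move=> h; rewrite normrM normrN [leRHS]mulrDl -(mulrA _ M).
  apply: le_trans (ler_pM _ _ (dbound u Iu) (Lh h)) _ => //.
  by rewrite lerDr mulr_ge0// ltW.
- move=> k k0.
  have lip := unif_differentiable_lipschitz M0 (fun u Iu => (b u Iu).2.2) r.
  have D3 : 0 < D ^+ 3 by rewrite exprn_gt0.
  have D5 : 0 < D ^+ 5 by rewrite exprn_gt0.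
  have M10 : 0 < M + 1 by rewrite addr_gt0.
  (* Half of [k] goes to the remainder of [f], multiplied by at most [D ^- 3]; the other half to the
     quadratic Taylor term, at most [D ^- 5 * ((M + 1) * |h|)^2], which [k2] controls through the
     size of [h]. *)
  have k1 : 0 < k / 2 * D ^+ 3 by rewrite mulr_gt0// divr_gt0.
  have k2 : 0 < k / 2 * D ^+ 5 / (M + 1) ^+ 2.
    by rewrite divr_gt0 ?exprn_gt0// mulr_gt0// divr_gt0.
  apply: filterS2 (filterI gef lip) (filterI (r _ k1) (near0_norm_le k2)).
  move=> h [ge_h lip_h] [r_h h_le] u Iu.
  have {}ge_h := ge_h u Iu; have {}lip_h := lip_h u Iu; have {}r_h := r_h u Iu.
  rewrite -D2 in ge_h.
  have T := rsqrt_taylor D0 (Df u Iu) ge_h.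
  set y := f (h + z) u in ge_h lip_h r_h T *.
  rewrite (_ : _ - _ = ((Num.sqrt y)^-1 - (Num.sqrt (f z u))^-1
     + (y - f z u) / (2 * Num.sqrt (f z u) ^+ 3))
     - (2 * Num.sqrt (f z u) ^+ 3)^-1 * (y - f z u - L u h)); last by ring.
  have -> : k * `|h| = k / 2 * `|h| + k / 2 * `|h| by field.
  rewrite (le_trans (ler_normB _ _))// lerD//.
    apply: le_trans T _; rewrite mulrC ler_pdivrMr// -real_normK ?num_real//.
    have : `|y - f z u| ^+ 2 <= ((M + 1) * `|h|) ^+ 2.
      by rewrite lerXn2r// nnegrE// mulr_ge0// ltW.
    move/le_trans; apply.
    have hh : `|h| * (M + 1) ^+ 2 <= k / 2 * D ^+ 5.
      by rewrite -ler_pdivlMr// exprn_gt0.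
    rewrite (_ : _ ^+ 2 = `|h| * (M + 1) ^+ 2 * `|h|); last by ring.
    rewrite (_ : _ * D ^+ 5 = k / 2 * D ^+ 5 * `|h|); last by ring.
    by rewrite ler_wpM2r.
  rewrite normrM; apply: le_trans (ler_pM _ _ (dbound u Iu) r_h) _ => //.
  rewrite [leLHS](_ : _ = k / 2 * `|h|)//.
  by field; rewrite lt0r_neq0.
- apply: filterS2 c gef0 => w cw fw u Iu.
  apply: continuousV; first by rewrite lt0r_neq0// sqrtr_gt0 fw.
  apply: (@continuous_comp _ _ _ (f w) Num.sqrt); first exact: cw.
  exact: sqrt_continuous.
- move=> h u Iu.
  have s0 := lt_le_trans D0 (Dsf u Iu).
  have cs : {for u, continuous (fun u => Num.sqrt (f z u))}.
    apply: (@continuous_comp _ _ _ (f z) Num.sqrt).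
      exact: nbhs_singleton c u Iu.
    exact: sqrt_continuous.
  apply: continuousM; last exact: cL.
  apply: continuousN; apply: continuousV.
    by rewrite mulf_neq0// expf_neq0// lt0r_neq0.
  apply: continuousM; first exact: cst_continuous.
  apply: (@continuous_comp _ _ _ (fun u => Num.sqrt (f z u)) (fun x => x ^+ 3)).
    exact: cs.
  exact: exprn_continuous.
Qed.

End UniformDifferentiability.

Lemma unif_differentiable_diff_along (R : realType) (V : normedModType R)
    (I : set R) (f : V -> R -> R) (z X : V) (u : R) (L : R -> V -> R) (M : R) :
  linear (L u) -> (forall h, `|L u h| <= M * `|h|) ->
  (forall e, 0 < e -> \forall h \near (0 : V), forall u, I u ->
    `|f (h + z) u - f z u - L u h| <= e * `|h|) ->
  I u -> diff_along (fun w => f w u) z X (L u X).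
Proof.
move=> lL bL rem Iu; apply: (diff_along_of_bound X lL bL) => e e0.
by apply: filterS (rem e e0) => h; exact.
Qed.

Lemma continuous_itv_integrable (R : realType) (a b : R) (f : R -> R) :
  (forall u, u \in `[a, b] -> {for u, continuous f}) ->
  (@lebesgue_measure R).-integrable `[a, b] (EFin \o f).
Proof.
move=> cf; apply: continuous_compact_integrable; first exact: segment_compact.
by apply: continuous_in_subspaceT => u; rewrite inE; exact: cf.
Qed.

(** The candidate differential is the integral of the differentials [L u]; the uniform remainder is
    integrated over a bounded interval. *)
Lemma diff_along_Rintegral (R : realType) (V : normedModType R) (a b : R)
    (f : V -> R -> R) (z X : V) (l : R -> R) :
  a < b -> unif_differentiable `[a, b] f z ->
  (forall u, u \in `[a, b] -> diff_along (fun w => f w u) z X (l u)) ->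
  diff_along (fun w => \int[@lebesgue_measure R]_(u in `[a, b]) f w u)%R z X
    (\int[@lebesgue_measure R]_(u in `[a, b]) l u)%R.
Proof.
move=> ab [L [M [M0 bd rem cf cL]]] fl.
set mu := @lebesgue_measure R.
have mI : measurable (`[a, b] : set (measurableTypeR R)) by [].
have iL h : mu.-integrable `[a, b] (EFin \o (L^~ h)).
  by apply: continuous_itv_integrable => u; exact: cL.
have If : \forall w \near z, mu.-integrable `[a, b] (EFin \o f w).
  by apply: filterS cf => w H; apply: continuous_itv_integrable => u; exact: H.
(* Both [l u] and [L u X] are the value at [X] of the differential of the same function. *)
have -> : (\int[mu]_(u in `[a, b]) l u)%R = (\int[mu]_(u in `[a, b]) L u X)%R.
  apply: eq_Rintegral => u; rewrite inE => uab.
  have [_ <-] := fl u uab; have [lL [_ bL]] := bd u uab.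
  by have [_ <-] := unif_differentiable_diff_along X lL bL rem uab.
have int_le (g : R -> R) (K : R) : mu.-integrable `[a, b] (EFin \o g) ->
    (forall u, u \in `[a, b] -> `|g u| <= K) ->
    `|(\int[mu]_(u in `[a, b]) g u)%R| <= K * (b - a).
  move=> ig gK; apply: le_trans (le_normr_Rintegral mI ig) _.
  apply: (@le_trans _ _ (\int[mu]_(u in `[a, b]) (cst K u))%R).
    apply: le_Rintegral => //.
    - exact: (integrable_norm ig).
    - by apply: continuous_itv_integrable => u _; exact: cst_continuous.
  by rewrite Rintegral_cst//= lebesgue_measure_itv/= lte_fin ab -EFinB.
apply: (@diff_along_of_bound _ _ _ (fun h => (\int[mu]_(u in `[a, b]) L u h)%R)
  _ _ (M * (b - a))).
- move=> k x y; rewrite -[k *: (Rintegral _ _ _)]/(k * Rintegral _ _ _).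
  rewrite -RintegralZl// -RintegralD//; last exact: (integrableZl mI k (iL x)).
  by apply: eq_Rintegral => u; rewrite inE => /bd[lL _]; rewrite lL.
- move=> h; rewrite mulrAC; apply: int_le (iL h) _ => u uab.
  by have [_ [_ ->]] := bd u uab.
(* The pointwise tolerance satisfies [e' * (b - a) <= e]. *)
- move=> e e0; pose e' := e / (b - a + 1).
  have ba0 : 0 <= b - a by rewrite subr_ge0 ltW.
  have e'0 : 0 < e' by rewrite divr_gt0// ltr_wpDl.
  have If' : \forall h \near (0 : V), mu.-integrable `[a, b] (EFin \o f (h + z)).
    by move: If; rewrite (near_shift 0 z); apply: filterS => h /=; rewrite subr0.
  apply: filterS2 (rem _ e'0) If' => h Hr ih.
  have iz := nbhs_singleton If.
  have i1 : mu.-integrable `[a, b] (EFin \o (fun u => f (h + z) u - f z u)).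
    exact: (integrableB mI ih iz).
  rewrite -RintegralB// -RintegralB//.
  apply: (@le_trans _ _ (e' * `|h| * (b - a))).
    apply: int_le => [|u uab]; last exact: Hr.
    exact: (integrableB mI i1 (iL h)).
  rewrite mulrAC ler_wpM2r// /e' mulrAC ler_pdivrMr ?ltr_wpDl//.
  by rewrite ler_pM2l//; lra.
Qed.

Lemma compact_itv_lower_bound (R : realType) (a b : R) (f : R -> R) : a <= b ->
  (forall u, u \in `[a, b] -> {for u, continuous f}) ->
  (forall u, u \in `[a, b] -> 0 < f u) ->
  exists2 e, 0 < e & forall u, u \in `[a, b] -> e <= f u.
Proof.
move=> ab cf f0.
have cf' : {within `[a, b], continuous f}.
  by apply: continuous_in_subspaceT => u; rewrite inE; exact: cf.
by have [c cab fc] := EVT_min ab cf'; exists (f c) => //; exact: f0.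
Qed.

(** * Brackets with D *)

Section Bracket.
Context {R : realType} {d : nat} (a m1 m2 : R) (z : 'rV[R]_d * 'rV[R]_d).
Notation phase := ('rV[R]_d * 'rV[R]_d)%type.
Notation eta := (eta_axis R d).
Hypothesis eta_unit : dotv eta eta = 1.
Hypothesis m1_gt0 : 0 < m1.
Hypothesis E_lt0 : E_Kep m1 z < 0.
Hypothesis C_gt0 : 0 < sq_ang_mom z.

Local Notation h := (half_dist a).
Local Notation r := (enorm z.1).
Local Notation s := (dotv z.1 z.2).
Local Notation n := (dotv z.2 z.2).
Local Notation y := (dotv z.1 eta).
Local Notation x := (dotv z.2 eta).
Local Notation w := (kfreq m1 z).
Local Notation rho := (semi_axis m1 z).
Local Notation X_D := (grad_v_D a m1 z, - grad_q_D a m1 z).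

Let q_neq0 : z.1 != 0 := sq_ang_mom_gt0_neq0 C_gt0.
Let w_neq0 : w != 0 := lt0r_neq0 (kfreq_gt0 E_lt0).
Let r_neq0 : r != 0 := enorm_neq0 q_neq0.

(** [D] is composed of first integrals of the Kepler problem, the squared angular momentum and a
    component of the Laplace-Runge-Lenz vector. Consequently [w] and [rho], functions of the energy,
    also commute with [D]. *)
Lemma diff_along_E_Kep_D : diff_along (E_Kep m1 : phase -> R) z X_D 0.
Proof.
apply: diff_along_eq; first exact: diff_along_E_Kep.
rewrite /grad_v_D /grad_q_D !dotvE (dotvC z.2 z.1) -(enorm_sqr z.1).
by field.
Qed.

Lemma diff_along_kfreq (X : phase) (l : R) :
  diff_along (E_Kep m1 : phase -> R) z X l ->
  diff_along (kfreq m1) z X (- l / w).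
Proof.
move=> dE.
have kE (p : phase) : kfreq m1 p = Num.sqrt (- 2 * E_Kep m1 p).
  by rewrite /kfreq /E_Kep enorm_sqr; congr Num.sqrt; lra.
rewrite (funext kE); apply: diff_along_eq.
  apply: diff_along_sqrt; last first.
    by apply: diff_along_mul; [exact: diff_along_cst|exact: dE].
  by rewrite mulNr oppr_gt0 pmulr_rlt0.
by rewrite -kE; field.
Qed.

Lemma diff_along_semi_axis (X : phase) (l : R) :
  diff_along (kfreq m1) z X l ->
  diff_along (semi_axis m1) z X (- (2 * m1 / w ^+ 3) * l).
Proof.
move=> dw; apply: diff_along_eq.
  apply: diff_along_mul; first exact: diff_along_cst.
  apply: diff_along_inv; first by rewrite expf_neq0.
  by apply: diff_along_exp; exact: dw.
by rewrite /=; field.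
Qed.

Definition orbit_eta (p : phase) (u : R) : R :=
  lagrange_f m1 p u * dotv p.1 eta + lagrange_g m1 p u * dotv p.2 eta.

(** The squared radius is written as a product, so that the product rules of [diff_along] and
    [unif_differentiable] match the body as it stands. *)
Definition sq_dist2 (p : phase) (u : R) : R :=
  orbit_rad m1 p u * orbit_rad m1 p u + 4 * h * orbit_eta p u + 4 * h ^+ 2.

Lemma sq_dist2E u :
  dotv (orbit_pos m1 z u - center2 d a) (orbit_pos m1 z u - center2 d a) =
  sq_dist2 z u.
Proof.
rewrite /sq_dist2 -expr2 -(dotv_orbit_pos E_lt0 C_gt0) /center2.
by rewrite /orbit_eta !dotvE eta_unit (dotvC eta) (dotvC z.2 z.1) ?(dotvC eta); ring.
Qed.

Lemma diff_along_r_D :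
  diff_along (fun p : phase => enorm p.1) z X_D (2 * h * (y * s - x * r ^+ 2) / r).
Proof.
apply: diff_along_eq; first exact: (@diff_along_enorm _ _ _ (fun p : phase => p.1)
  _ _ _ q_neq0 (fun i => diff_along_q i _ _)).
rewrite /= /grad_v_D !dotvE -(enorm_sqr z.1).
by field.
Qed.

Lemma diff_along_s_D :
  diff_along (fun p : phase => dotv p.1 p.2) z X_D (2 * h * (n * y - s * x)).
Proof.
apply: diff_along_eq.
  exact: (@diff_along_dotv _ _ _ (fun p : phase => p.1) (fun p : phase => p.2)
    _ _ _ _ (fun i => diff_along_q i _ _) (fun i => diff_along_v i _ _)).
rewrite /= /grad_v_D /grad_q_D !dotvE !(dotvC eta).
rewrite -(enorm_sqr z.1); by field.
Qed.

Lemma diff_along_y_D :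
  diff_along (fun p : phase => dotv p.1 eta) z X_D
    (2 * (r ^+ 2 * x - s * y) + 2 * h * (x * y - s)).
Proof.
apply: diff_along_eq.
  exact: (@diff_along_dotv_cst _ _ _ (fun p : phase => p.1) _ _ _ _
    (fun i => diff_along_q i _ _)).
rewrite /= /grad_v_D !dotvE eta_unit -(enorm_sqr z.1).
by ring.
Qed.

Lemma diff_along_x_D :
  diff_along (fun p : phase => dotv p.2 eta) z X_D
    (- (2 * (n * y - s * x)
        + 2 * h * (n - m1 / r - x ^+ 2 + m1 * y ^+ 2 / r ^+ 3))).
Proof.
apply: diff_along_eq.
  exact: (@diff_along_dotv_cst _ _ _ (fun p : phase => p.2) _ _ _ _
    (fun i => diff_along_v i _ _)).
rewrite /= /grad_q_D !dotvE eta_unit.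
by field.
Qed.

Lemma diff_along_kfreq_D : diff_along (kfreq m1) z X_D 0.
Proof.
apply: diff_along_eq; first exact: diff_along_kfreq diff_along_E_Kep_D.
by rewrite oppr0 mul0r.
Qed.

Lemma diff_along_semi_axis_D : diff_along (semi_axis m1) z X_D 0.
Proof.
apply: diff_along_eq; first exact: diff_along_semi_axis diff_along_kfreq_D.
by rewrite mulr0.
Qed.

Definition du_rad (u : R) : R := s / w * cos u - (r - rho) * sin u.

Definition du_eta (u : R) : R :=
  - (rho / r * sin u) * y + (s / w ^+ 2 * sin u + r / w * cos u) * x.

(** As [w] and [rho] commute with [D], only [r] and [s] contribute. The term with [y / r] is a
    multiple of the [u]-derivative: the origin of the anomaly is shifted. *)
Lemma diff_along_orbit_rad_D u :
  diff_along (fun p => orbit_rad m1 p u) z X_D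
    (2 * h * w * (y / r * du_rad u - du_eta u)).
Proof.
have dr := diff_along_r_D; have ds := diff_along_s_D.
have dw := diff_along_kfreq_D; have drho := diff_along_semi_axis_D.
have dcst := @diff_along_cst _ _ _ z X_D.
have dwV := diff_along_inv w_neq0 dw.
have := diff_along_add (diff_along_add drho
  (diff_along_mul (diff_along_add dr (diff_along_opp drho)) (dcst (cos u))))
  (diff_along_mul (diff_along_mul ds dwV) (dcst (sin u))).
move=> /diff_along_eq; apply.
rewrite /= /du_rad /du_eta (dotv_vvE E_lt0 C_gt0); field.
by rewrite w_neq0 r_neq0.
Qed.

(** The term without [h] comes from the squared angular momentum, whose flow rotates the orbit in
    its own plane: it moves [Y] but leaves the radius alone. The term with [y / r] is the same shift
    of the anomaly as for the radius. *)
Lemma diff_along_orbit_eta_D u :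
  diff_along (fun p => orbit_eta p u) z X_D
    (2 * w * (orbit_rad m1 z u * du_eta u - du_rad u * orbit_eta z u)
     - 2 * h * w * du_rad u + 2 * h * w * (y / r) * du_eta u).
Proof.
have dr := diff_along_r_D; have ds := diff_along_s_D.
have dy := diff_along_y_D; have dx := diff_along_x_D.
have dw := diff_along_kfreq_D; have drho := diff_along_semi_axis_D.
have dcst := @diff_along_cst _ _ _ z X_D.
have dwV := diff_along_inv w_neq0 dw.
have dw2V := diff_along_inv (f := fun p => kfreq m1 p ^+ 2)
  (expf_neq0 2 w_neq0) (diff_along_exp 1 dw).
have drV := diff_along_inv (f := fun p : phase => enorm p.1) r_neq0 dr.
have df := diff_along_add (dcst 1) (diff_along_opp (diff_along_mul
  (diff_along_mul drho drV) (dcst (1 - cos u)))).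
have dg := diff_along_add (diff_along_mul (diff_along_mul ds dw2V)
  (dcst (1 - cos u))) (diff_along_mul (diff_along_mul dr dwV) (dcst (sin u))).
have := diff_along_add (diff_along_mul df dy) (diff_along_mul dg dx).
move=> /diff_along_eq; apply.
have CS : sin u ^+ 2 = 1 - cos u ^+ 2 by rewrite sin2cos2.
have m1w := m1E E_lt0.
rewrite /= /du_rad /du_eta /orbit_eta /orbit_rad /lagrange_f /lagrange_g.
rewrite (dotv_vvE E_lt0 C_gt0); field: CS m1w.
by rewrite w_neq0 r_neq0.
Qed.

Definition avg_integrand (p : phase) (u : R) : R :=
  - m2 * (Num.sqrt (sq_dist2 p u))^-1 * (orbit_rad m1 p u * (kfreq m1 p)^-1).

(** The summand with [y / r] integrates the shift of the anomaly, being a multiple of the integrand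
    itself; the rest integrates the remaining terms of the bracket. *)
Definition avg_primitive (u : R) : R :=
  2 * h * m2 * (2 * orbit_eta z u + 2 * h - y / r * orbit_rad m1 z u)
  * (Num.sqrt (sq_dist2 z u))^-1.

(** Written as the expanded [u]-derivative of [avg_primitive]; the bracket of the integrand with [D]
    is then matched to it. *)
Definition avg_bracket (u : R) : R :=
  2 * h * m2 * ((2 * du_eta u - y / r * du_rad u) * (Num.sqrt (sq_dist2 z u))^-1
   - (2 * orbit_eta z u + 2 * h - y / r * orbit_rad m1 z u)
     * (orbit_rad m1 z u * du_rad u + 2 * h * du_eta u)
     * (Num.sqrt (sq_dist2 z u)) ^- 3).

Lemma diff_along_sq_dist2_D u :
  diff_along (fun p => sq_dist2 p u) z X_D
   (4 * h * w * (orbit_rad m1 z u * (y / r * du_rad u - du_eta u)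
     + 2 * (orbit_rad m1 z u * du_eta u - du_rad u * orbit_eta z u)
     - 2 * h * du_rad u + 2 * h * (y / r) * du_eta u)).
Proof.
have dR := diff_along_orbit_rad_D u; have dY := diff_along_orbit_eta_D u.
have dcst := @diff_along_cst _ _ _ z X_D.
have := diff_along_add (diff_along_add (diff_along_mul dR dR)
  (diff_along_mul (dcst (4 * h)) dY)) (dcst (4 * h ^+ 2)).
by move=> /diff_along_eq; apply; rewrite /=; ring.
Qed.

Lemma diff_along_avg_integrand_D u : 0 < sq_dist2 z u ->
  diff_along (avg_integrand^~ u) z X_D (avg_bracket u).
Proof.
move=> N0; have sN0 : Num.sqrt (sq_dist2 z u) != 0 by rewrite lt0r_neq0// sqrtr_gt0.
have dR := diff_along_orbit_rad_D u; have dN := diff_along_sq_dist2_D u.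
have dcst := @diff_along_cst _ _ _ z X_D.
have := diff_along_mul (diff_along_mul (dcst (- m2))
   (diff_along_rsqrt (f := sq_dist2^~ u) N0 dN))
  (diff_along_mul dR (diff_along_inv w_neq0 diff_along_kfreq_D)).
move=> /diff_along_eq; apply.
have NE : Num.sqrt (sq_dist2 z u) ^+ 2 =
    orbit_rad m1 z u ^+ 2 + 4 * h * orbit_eta z u + 4 * h ^+ 2.
  by rewrite sqr_sqrtr 1?ltW// /sq_dist2; ring.
rewrite /= /avg_bracket; move: sN0 NE.
(* What remains is an identity in free variables for the radius, the eta-coordinate and their
   [u]-derivatives, subject only to the relation [NE] for the square of the distance. *)
move: (Num.sqrt _) (orbit_rad _ _ _) (orbit_eta _ _) (du_rad u) (du_eta u).
move=> N Rd Y dRd dY N_neq0 NE.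
field: NE.
by rewrite w_neq0 r_neq0 N_neq0.
Qed.

Lemma diff_along_du_rad u : diff_along (orbit_rad m1 z) u 1 (du_rad u).
Proof. exact: diff_along_orbit_rad. Qed.

Lemma diff_along_du_eta u : diff_along (orbit_eta z) u 1 (du_eta u).
Proof.
apply: diff_along_eq.
  apply: diff_along_add; apply: diff_along_mul; try exact: diff_along_cst.
    exact: diff_along_lagrange_f.
  exact: diff_along_lagrange_g.
by rewrite /du_eta /=; ring.
Qed.

Lemma diff_along_sq_dist2_u u : diff_along (sq_dist2 z) u 1
  (2 * (orbit_rad m1 z u * du_rad u + 2 * h * du_eta u)).
Proof.
have dR := diff_along_du_rad u; have dY := diff_along_du_eta u.
have dcst c := @diff_along_cst _ _ c u (1 : R).
have := diff_along_add (diff_along_add (diff_along_mul dR dR)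
  (diff_along_mul (dcst (4 * h)) dY)) (dcst (4 * h ^+ 2)).
by move=> /diff_along_eq; apply; rewrite /=; ring.
Qed.

Lemma diff_along_avg_primitive u : 0 < sq_dist2 z u ->
  diff_along avg_primitive u 1 (avg_bracket u).
Proof.
move=> N0; have sN0 : Num.sqrt (sq_dist2 z u) != 0 by rewrite lt0r_neq0// sqrtr_gt0.
have dR := diff_along_du_rad u; have dY := diff_along_du_eta u.
have dN := diff_along_sq_dist2_u u.
have dcst c := @diff_along_cst _ _ c u (1 : R).
have := diff_along_mul (diff_along_mul (dcst (2 * h * m2))
  (diff_along_add (diff_along_add (diff_along_mul (dcst 2) dY) (dcst (2 * h)))
   (diff_along_opp (diff_along_mul (dcst (y / r)) dR))))
  (diff_along_rsqrt (f := sq_dist2 z) N0 dN).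
move=> /diff_along_eq; apply.
rewrite /= /avg_bracket; field.
by rewrite r_neq0 sN0.
Qed.

End Bracket.

(** The fundamental theorem of calculus needs continuity, obtained here from differentiability with
    the derivative left to unification. *)
Lemma continuous_avg_bracket (R : realType) (d : nat) (a m1 m2 : R)
    (z : 'rV[R]_d * 'rV[R]_d) (u : R) :
  0 < sq_dist2 a m1 z u -> {for u, continuous (avg_bracket a m1 m2 z)}.
Proof.
move=> N0; have sN0 : Num.sqrt (sq_dist2 a m1 z u) != 0.
  by rewrite lt0r_neq0// sqrtr_gt0.
have dR := diff_along_du_rad m1 z u; have dY := diff_along_du_eta m1 z u.
have dN := diff_along_sq_dist2_u a m1 z u.
have dcst c := @diff_along_cst _ _ c u (1 : R).
have dC := diff_along_cos u; have dS := diff_along_sin u.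
have ddR := diff_along_add (diff_along_mul (dcst (dotv z.1 z.2 / kfreq m1 z)) dC)
  (diff_along_opp (diff_along_mul (dcst (enorm z.1 - semi_axis m1 z)) dS)).
have ddY := diff_along_add
  (diff_along_mul (diff_along_opp
     (diff_along_mul (dcst (semi_axis m1 z / enorm z.1)) dS))
     (dcst (dotv z.1 (eta_axis R d))))
  (diff_along_mul (diff_along_add
     (diff_along_mul (dcst (dotv z.1 z.2 / kfreq m1 z ^+ 2)) dS)
     (diff_along_mul (dcst (enorm z.1 / kfreq m1 z)) dC))
     (dcst (dotv z.2 (eta_axis R d)))).
have dNV := diff_along_rsqrt (f := sq_dist2 a m1 z) N0 dN.
have dN3V := diff_along_inv (f := fun u => Num.sqrt (sq_dist2 a m1 z u) ^+ 3)
  (expf_neq0 3 sN0) (diff_along_exp 2 (diff_along_sqrt (f := sq_dist2 a m1 z) N0 dN)).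
have dbr := diff_along_mul (dcst (2 * half_dist a * m2)) (diff_along_add
  (diff_along_mul (diff_along_add (diff_along_mul (dcst 2) ddY) (diff_along_opp
    (diff_along_mul (dcst (dotv z.1 (eta_axis R d) / enorm z.1)) ddR))) dNV)
  (diff_along_opp (diff_along_mul (diff_along_mul
    (diff_along_add (diff_along_add (diff_along_mul (dcst 2) dY)
       (dcst (2 * half_dist a)))
       (diff_along_opp (diff_along_mul
         (dcst (dotv z.1 (eta_axis R d) / enorm z.1)) dR)))
    (diff_along_add (diff_along_mul dR ddR)
       (diff_along_mul (dcst (2 * half_dist a)) ddY))) dN3V))).
exact: (diff_along_continuous dbr).
Qed.

(** * Differentiability of the average and its bracket with [D] *)

Section AveragedBracket.
Context {R : realType} {d : nat} (a m1 m2 : R) (z : 'rV[R]_d * 'rV[R]_d).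
Notation phase := ('rV[R]_d * 'rV[R]_d)%type.
Notation eta := (eta_axis R d).
Hypothesis eta_unit : dotv eta eta = 1.
Hypothesis m1_gt0 : 0 < m1.
Hypothesis E_lt0 : E_Kep m1 z < 0.
Hypothesis C_gt0 : 0 < sq_ang_mom z.
Local Notation I := (`[0, pi *+ 2] : interval R).
Local Notation UD := (unif_differentiable [set` I]).

Let q_neq0 : z.1 != 0 := sq_ang_mom_gt0_neq0 C_gt0.
Let w_neq0 : kfreq m1 z != 0 := lt0r_neq0 (kfreq_gt0 E_lt0).
Let r_neq0 : enorm z.1 != 0 := enorm_neq0 q_neq0.

Let UD_cos : UD (fun _ u => cos u) z.
Proof.
apply: (@unif_differentiable_param _ _ _ _ _ 1) => u _; first exact: cos_max.
exact: continuous_cos.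
Qed.

Let UD_sin : UD (fun _ u => sin u) z.
Proof.
apply: (@unif_differentiable_param _ _ _ _ _ 1) => u _; first exact: sin_max.
exact: continuous_sin.
Qed.

Let UD_num (c : R) : UD (fun _ _ => c) z.
Proof. exact: (unif_differentiable_cst _ (differentiable_cst c z)). Qed.

Let UD_opp f : UD f z -> UD (fun p u => - f p u) z.
Proof.
move=> Hf; rewrite (_ : (fun _ => _) = fun p u => -1 * f p u).
  exact: unif_differentiable_mul.
by apply/funext => p; apply/funext => u; rewrite mulN1r.
Qed.

(** Here and in the next facts, differentiability is extracted from the bracket computations, which
    carry it as their first component. *)
Let UD_r : UD (fun (p : phase) _ => enorm p.1) z.
Proof. by apply: unif_differentiable_cst; have [] := diff_along_r_D a m1 C_gt0. Qed.

Let UD_s : UD (fun (p : phase) _ => dotv p.1 p.2) z.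
Proof. by apply: unif_differentiable_cst; have [] := diff_along_s_D a m1 C_gt0. Qed.

Let UD_y : UD (fun (p : phase) _ => dotv p.1 eta) z.
Proof. by apply: unif_differentiable_cst; have [] := diff_along_y_D a m1 z eta_unit. Qed.

Let UD_x : UD (fun (p : phase) _ => dotv p.2 eta) z.
Proof. by apply: unif_differentiable_cst; have [] := diff_along_x_D a m1 eta_unit C_gt0. Qed.

Let UD_rho : UD (fun (p : phase) _ => semi_axis m1 p) z.
Proof. by apply: unif_differentiable_cst; have [] := diff_along_semi_axis_D a E_lt0 C_gt0. Qed.

Let UD_wV : UD (fun (p : phase) _ => (kfreq m1 p)^-1) z.
Proof.
by apply: unif_differentiable_cst;
  have [] := diff_along_inv w_neq0 (diff_along_kfreq_D a E_lt0 C_gt0).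
Qed.

Let UD_w2V : UD (fun (p : phase) _ => (kfreq m1 p ^+ 2)^-1) z.
Proof.
by apply: unif_differentiable_cst;
  have [] := diff_along_inv (f := fun p => kfreq m1 p ^+ 2) (expf_neq0 2 w_neq0)
    (diff_along_exp 1 (diff_along_kfreq_D a E_lt0 C_gt0)).
Qed.

Let UD_rV : UD (fun (p : phase) _ => (enorm p.1)^-1) z.
Proof.
by apply: unif_differentiable_cst;
  have [] := diff_along_inv (f := fun p : phase => enorm p.1) r_neq0
    (diff_along_r_D a m1 C_gt0).
Qed.

Let UD_rad : UD (orbit_rad m1) z.
Proof.
exact: (unif_differentiable_add
  (unif_differentiable_add UD_rho
    (unif_differentiable_mul (unif_differentiable_add UD_r (UD_opp UD_rho)) UD_cos))
  (unif_differentiable_mul (unif_differentiable_mul UD_s UD_wV) UD_sin)).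
Qed.

Let UD_eta : UD (orbit_eta m1) z.
Proof.
have UD_1cos := unif_differentiable_add (UD_num 1) (UD_opp UD_cos).
have UD_f := unif_differentiable_add (UD_num 1) (UD_opp
  (unif_differentiable_mul (unif_differentiable_mul UD_rho UD_rV) UD_1cos)).
have UD_g := unif_differentiable_add
  (unif_differentiable_mul (unif_differentiable_mul UD_s UD_w2V) UD_1cos)
  (unif_differentiable_mul (unif_differentiable_mul UD_r UD_wV) UD_sin).
exact: (unif_differentiable_add (unif_differentiable_mul UD_f UD_y)
  (unif_differentiable_mul UD_g UD_x)).
Qed.

Let UD_sq_dist2 : UD (sq_dist2 a m1) z.
Proof.
exact: (unif_differentiable_add (unif_differentiable_add
  (unif_differentiable_mul UD_rad UD_rad)
  (unif_differentiable_mul (UD_num (4 * half_dist a)) UD_eta))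
  (UD_num (4 * half_dist a ^+ 2))).
Qed.

Hypothesis far : forall u, orbit_pos m1 z u != center2 d a.

Let sq_dist2_gt0 u : 0 < sq_dist2 a m1 z u.
Proof. by rewrite -sq_dist2E// dotv_gt0// subr_eq0. Qed.

(** Compactness of one period turns avoidance of the second center into a positive distance; this
    keeps the inverse distance uniformly differentiable and survives at nearby initial points. *)
Lemma sq_dist2_lower_bound :
  exists2 e, 0 < e & forall u, u \in I -> e <= sq_dist2 a m1 z u.
Proof.
apply: compact_itv_lower_bound => [|u _|u _] //.
  by rewrite mulrn_wge0// pi_ge0.
exact: diff_along_continuous (diff_along_sq_dist2_u a m1 z u).
Qed.

Let UD_avg_integrand : UD (avg_integrand a m1 m2) z.
Proof.
have [e e0 Ne] := sq_dist2_lower_bound.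
exact: (unif_differentiable_mul (unif_differentiable_mul (UD_num (- m2))
  (unif_differentiable_rsqrt UD_sq_dist2 e0 Ne)) (unif_differentiable_mul UD_rad UD_wV)).
Qed.

Let near_E_lt0 : \forall p \near z, E_Kep m1 p < 0.
Proof.
have [/differentiable_continuous cE _] := diff_along_E_Kep_D a m1 C_gt0.
by have := cE _ (lt_nbhsl E_lt0).
Qed.

Let near_C_gt0 : \forall p \near z, 0 < sq_ang_mom p.
Proof.
have cC : {for z, continuous (@sq_ang_mom R d)}.
  apply: differentiable_continuous.
  rewrite (_ : @sq_ang_mom R d = fun p => dotv p.1 p.1 * dotv p.2 p.2
    - dotv p.1 p.2 ^+ 2); last first.
    by apply/funext => p; rewrite /sq_ang_mom !enorm_sqr.
  have dv := @diff_along_dotv _ _ _ (fun p : phase => p.2) (fun p : phase => p.2)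
    z z _ _ (fun i => diff_along_v i _ _) (fun i => diff_along_v i _ _).
  have dq := @diff_along_dotv _ _ _ (fun p : phase => p.1) (fun p : phase => p.1)
    z z _ _ (fun i => diff_along_q i _ _) (fun i => diff_along_q i _ _).
  have ds := @diff_along_dotv _ _ _ (fun p : phase => p.1) (fun p : phase => p.2)
    z z _ _ (fun i => diff_along_q i _ _) (fun i => diff_along_v i _ _).
  by have [] := diff_along_add (diff_along_mul dq dv)
    (diff_along_opp (diff_along_exp 1 ds)).
by have := cC _ (lt_nbhsr C_gt0).
Qed.

(** Negative energy, nonzero angular momentum and the lower bound on the distance all persist near
    [z], so the change of variables is valid on a whole neighborhood, as differentiation
    requires. *)
Let V_avg_near : \forall p \near z,
  (2 * pi * semi_axis m1 p * (kfreq m1 p)^-1)^-1 *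
    (\int[@lebesgue_measure R]_(u in [set` I]) avg_integrand a m1 m2 p u)%R
  = V_avg a m1 m2 p.
Proof.
have [e e0 Ne] := sq_dist2_lower_bound.
have := unif_differentiable_near_gt UD_sq_dist2 e0 Ne.
have -> : (\forall h \near (0 : phase), forall u, u \in I ->
    e / 2 <= sq_dist2 a m1 (h + z) u) =
  (\forall p \near z, forall u, u \in I -> e / 2 <= sq_dist2 a m1 p u).
  by rewrite (near_shift 0 z) subr0.
move=> nN; apply: filterS3 near_E_lt0 near_C_gt0 nN => p pE pC pN.
have pfar u : u \in I -> orbit_pos m1 p u != center2 d a.
  move=> uI; rewrite -subr_eq0 -dotv_eq0 sq_dist2E// lt0r_neq0//.
  by apply: lt_le_trans (pN u uI); rewrite divr_gt0.
rewrite V_avgE//; congr (_ * _); apply: eq_Rintegral => u _.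
by rewrite /V_Eucl2 /enorm sq_dist2E// /avg_integrand; ring.
Qed.

Lemma diff_along_V_avg_D :
  diff_along (V_avg a m1 m2 : phase -> R) z
    (grad_v_D a m1 z, - grad_q_D a m1 z) 0.
Proof.
apply: diff_along_near V_avg_near _.
have pi2 : 0 < pi *+ 2 :> R by rewrite mulrn_wgt0// pi_gt0.
have cb u := continuous_avg_bracket (sq_dist2_gt0 u).
(* The bracket of the integrand is the derivative of the periodic [avg_primitive], so its integral
   over a period vanishes. *)
have int0 : (\int[@lebesgue_measure R]_(u in [set` I]) avg_bracket a m1 m2 z u)%R = 0.
  have per : avg_primitive a m1 m2 z (pi *+ 2) = avg_primitive a m1 m2 z 0.
    rewrite /avg_primitive /sq_dist2 /orbit_eta /orbit_rad /lagrange_f.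
    by rewrite /lagrange_g sin2pi cos2pi sin0 cos0.
  rewrite /Rintegral (@continuous_FTC2 _ _ (avg_primitive a m1 m2 z))//.
  - by rewrite per -EFinB subrr.
  - by apply: continuous_in_subspaceT => u _; exact: cb.
  - have dP u := diff_along_avg_primitive m2 C_gt0 (sq_dist2_gt0 u).
    split=> [u _||].
    + by have [] := diff_along_is_derive (dP u).
    + by apply: cvg_at_right_filter; exact: diff_along_continuous (dP 0).
    + by apply: cvg_at_left_filter; exact: diff_along_continuous (dP (pi *+ 2)).
  - move=> u _; rewrite derive1E.
    by have [_ ->] := diff_along_is_derive (diff_along_avg_primitive m2 C_gt0 (sq_dist2_gt0 u)).
have dI := diff_along_Rintegral pi2 UD_avg_integrand
  (fun u _ => diff_along_avg_integrand_D m2 eta_unit E_lt0 C_gt0 (sq_dist2_gt0 u)).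
rewrite int0 in dI.
have dw := diff_along_kfreq_D a E_lt0 C_gt0.
have drho := diff_along_semi_axis_D a E_lt0 C_gt0.
have dT := diff_along_mul (diff_along_mul (diff_along_cst (2 * pi) z
  (grad_v_D a m1 z, - grad_q_D a m1 z)) drho) (diff_along_inv w_neq0 dw).
have T0 : 2 * pi * semi_axis m1 z * (kfreq m1 z)^-1 != 0.
  have rho0 := semi_axis_gt0 m1_gt0 E_lt0.
  by rewrite lt0r_neq0// divr_gt0 ?kfreq_gt0// mulr_gt0// mulr_gt0// pi_gt0.
(* In the product rule both terms vanish: the prefactor depends on [w] and [rho] only, and the
   integral has derivative zero. *)
apply: diff_along_eq (diff_along_mul (diff_along_inv
  (f := fun p => 2 * pi * semi_axis m1 p * (kfreq m1 p)^-1) T0 dT) dI) _.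
by rewrite !(mulr0, addr0, mul0r).
Qed.

End AveragedBracket.

(** * From the region to the hypotheses used above, and the conclusion *)

(** The squared length of [p], which is [q . q] times the component of [v] orthogonal to [q], equals
    [q . q] times the squared angular momentum. If [p] vanished, [v] would be a multiple of [q] and
    the bivector zero. *)
Lemma sq_ang_mom_gt0 (R : realType) (d : nat) (z : 'rV[R]_d * 'rV[R]_d) :
  bivector z.1 z.2 != 0 -> 0 < sq_ang_mom z.
Proof.
move=> C0.
have q0 : z.1 != 0.
  apply: contraNneq C0 => q0; apply/eqP/matrixP => i j.
  by rewrite !mxE q0 !mxE !mul0r subrr.
have r0 := dotv_gt0 q0.
set p := dotv z.1 z.1 *: z.2 - dotv z.1 z.2 *: z.1.
have pE : dotv p p = dotv z.1 z.1 * sq_ang_mom z.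
  by rewrite /p /sq_ang_mom !enorm_sqr !dotvE (dotvC z.2 z.1); ring.
rewrite -(pmulr_rgt0 _ r0) -pE dotv_gt0//.
apply: contraNneq C0 => p0; apply/eqP/matrixP => i j; rewrite !mxE.
have vE k : z.2 0 k = dotv z.1 z.2 / dotv z.1 z.1 * z.1 0 k.
  have /rowP/(_ k)/eqP := p0; rewrite !mxE subr_eq0 => /eqP H.
  by rewrite mulrAC -H; field; exact: lt0r_neq0.
by rewrite !vE; ring.
Qed.

Lemma regionR_orbit_far (R : realType) (d : nat) (a m1 : R)
    (z : 'rV[R]_d * 'rV[R]_d) (u : R) : 0 < m1 -> regionR a m1 z ->
  orbit_pos m1 z u != center2 d a.
Proof.
move=> m1_gt0 [E_lt0 /sq_ang_mom_gt0 C_gt0 far].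
apply/eqP => posE; apply: far.
have [fs f0] := kepler_flowP m1_gt0 E_lt0 C_gt0.
set t := orbit_time m1 z u.
have lt_t : `|t| < `|t| + 1 by rewrite ltrDl.
(* The flow itself, restricted to an open interval around both [0] and [t], would witness an orbit
   through the second center. *)
exists (- (`|t| + 1)), (`|t| + 1), t, (kepler_flow m1 z); split => //.
- by rewrite oppr_lt0 ltr_wpDl.
- by rewrite -ltr_norml.
- by move=> x _; exact: fs.
- by rewrite kepler_flow_orbit.
Qed.

(** Differentiability belongs to the conclusion because the partial derivatives in [poisson] take
    default values where they do not exist. *)
Theorem proposition2p2 (R : realType) (d : nat) (a m1 m2 : R)
  (hd : (2 <= d)%N) (ha : 0 < a) (hm1 : 0 < m1)
  (z : 'rV[R]_d * 'rV[R]_d) (hz : regionR a m1 z) :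
  [/\ differentiable (E_avg a m1 m2 : 'rV[R]_d * 'rV[R]_d -> R) z,
      differentiable (D_int a m1 : 'rV[R]_d * 'rV[R]_d -> R) z
    & poisson (E_avg a m1 m2) (D_int a m1) z = 0].
Proof.
(* In a successor dimension [eta_axis] is a unit vector, which enters the distance to the second
   center and the brackets. *)
case: d hd z hz => // d _ z hz.
have far u := regionR_orbit_far u hm1 hz.
have [E_lt0 /sq_ang_mom_gt0 C_gt0 _] := hz.
have q0 := sq_ang_mom_gt0_neq0 C_gt0.
have dE := diff_along_add (diff_along_E_Kep_D a m1 C_gt0)
  (diff_along_V_avg_D m2 (dotv_eta_axis R d) hm1 E_lt0 C_gt0 far).
rewrite addr0 in dE.
have [dD _] := diff_along_D_int a m1 z q0.
by split; [case: dE|exact: dD|exact: poisson_D_int q0 dE].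
Qed.
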